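(* Let $W=S_{l+1}$ be the Weyl group of $\mathfrak g=\mathfrak{sl}_{l+1}(\mathbb C)$, with root system $\Delta$. Let $s\in W$ be a single cycle (of length greater than one) represented as a product $s=s_1s_2$ of two involutions $s_1=s_{\gamma_1}\cdots s_{\gamma_n}$ and $s_2=s_{\gamma_{n+1}}\cdots s_{\gamma_{l'}}$, and let $\Delta_+$ be any system of positive roots in $\Delta$, with simple roots $\alpha_1,\dots,\alpha_l$. Put $m=\lfloor\frac12(l'-1)\rfloor$, $p=l-l'$ and $\gamma=\alpha_{m+1}+\cdots+\alpha_{m+p+1}$. Then $\Delta_+$ is associated to $s$ when the sets $\{\gamma_1,\dots,\gamma_n\}$, $\{\gamma_{n+1},\dots,\gamma_{l'}\}$ have one of the following forms. (i) For $m$ even and $l'$ odd, $$\{\gamma_1,\dots,\gamma_n\}=\{\alpha_2,\alpha_4,\dots,\alpha_m,\alpha_{m+p+2},\alpha_{m+p+4},\dots,\alpha_{m+p+m}\},$$ $$\{\gamma_{n+1},\dots,\gamma_{l'}\}=\{\alpha_1,\alpha_3,\dots,\alpha_{m-1},\gamma,\alpha_{m+p+3},\alpha_{m+p+5},\dots,\alpha_{m+p+m+1}\}.$$ (ii) For $m$ even and $l'$ even, $$\{\gamma_1,\dots,\gamma_n\}=\{\alpha_2,\alpha_4,\dots,\alpha_m,\alpha_{m+p+2},\alpha_{m+p+4},\dots,\alpha_{m+p+m+2}\},$$ $$\{\gamma_{n+1},\dots,\gamma_{l'}\}=\{\alpha_1,\alpha_3,\dots,\alpha_{m-1},\gamma,\alpha_{m+p+3},\alpha_{m+p+5},\dots,\alpha_{m+p+m+1}\}.$$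 (iii) For $m$ odd and $l'$ odd, $$\{\gamma_1,\dots,\gamma_n\}=\{\alpha_1,\alpha_3,\dots,\alpha_m,\alpha_{m+p+2},\alpha_{m+p+4},\dots,\alpha_{m+p+m+1}\},$$ $$\{\gamma_{n+1},\dots,\gamma_{l'}\}=\{\alpha_2,\alpha_4,\dots,\alpha_{m-1},\gamma,\alpha_{m+p+3},\alpha_{m+p+5},\dots,\alpha_{m+p+m}\}.$$ (iv) For $m$ odd and $l'$ even, $$\{\gamma_1,\dots,\gamma_n\}=\{\alpha_1,\alpha_3,\dots,\alpha_m,\alpha_{m+p+2},\alpha_{m+p+4},\dots,\alpha_{m+p+m+1}\},$$ $$\{\gamma_{n+1},\dots,\gamma_{l'}\}=\{\alpha_2,\alpha_4,\dots,\alpha_{m-1},\gamma,\alpha_{m+p+3},\alpha_{m+p+5},\dots,\alpha_{m+p+m+2}\}.$$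
   Context: Here $\mathfrak h\subset\mathfrak{sl}_{l+1}$ is the diagonal Cartan subalgebra, $\Delta$ is the root system of $(\mathfrak g,\mathfrak h)$, $s_\alpha\in W$ is the reflection in $\alpha$, and the simple roots $\alpha_1,\dots,\alpha_l$ of $\Delta_+$ are numbered in the standard type $A_l$ order, so that the positive roots are $\alpha_i+\alpha_{i+1}+\cdots+\alpha_j$, $1\le i\le j\le l$. In the displayed lists the indices increase in steps of $2$, and a list whose last index is smaller than its first is empty. Meaning of ''$\Delta_+$ is associated to $s$''. The element $s$ acts on the real span $\mathfrak h_{\mathbb R}$ of the simple coroots as an orthogonal transformation (for the Killing form). Decompose $\mathfrak h_{\mathbb R}=\bigoplus_{i=0}^K\mathfrak h_i$ into $s$-invariant subspaces, where $\mathfrak h_0$ is the subspace of vectors fixed by $s$ and, for $1\le i\le K$, $\mathfrak h_i$ is one- or two-dimensional and $s$ acts on it as rotation by an angle $\theta_i$ with $0<\theta_i\le\pi$. The non-fixed subspaces are ordered so that $\mathfrak h_i$ is written before $\mathfrak h_j$ if $\theta_i>\theta_j$ (so $\mathfrak h_K$ has the smallest angle). For each $i=0,\dots,K$ choose $h_i\in\mathfrak h_i$ such that $h_i(\alpha)\neq0$ for every root $\alpha\in\Delta$ not orthogonal to $\mathfrak h_i$ with respect to the Killing form (here $h_i(\alpha)$ denotes the pairing of $h_i$ and $\alpha$). Put $$\overline\Delta_i=\{\alpha\in\Delta: h_i(\alpha)\ne0,\ h_j(\alpha)=0\text{ for all } j>i\},$$ and let $\overline\Delta_{i_0},\dots,\overline\Delta_{i_M}$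 with $i_0<\dots<i_M$ be the non-empty ones among these sets. After rescaling the $h_i$, assume $|h_{i_k}(\alpha)|>|\sum_{r\le j<k}h_{i_j}(\alpha)|$ for all $\alpha\in\overline\Delta_{i_k}$, $0\le k\le M$, and $r<k$. Then $\bar h=\sum_{k=0}^Mh_{i_k}$ lies in an open Weyl chamber and defines the system of positive roots $\{\alpha\in\Delta:\bar h(\alpha)>0\}$; a root $\alpha\in\overline\Delta_{i_k}$ is positive if and only if $h_{i_k}(\alpha)>0$. A system of positive roots is associated to $s$ if it arises in this way from $s$ (for suitable choices of the $h_i$). *)

(* Defs.v *)
From HB Require Import structures.
From mathcomp Require Import all_boot all_order all_algebra all_fingroup.
From mathcomp Require Import reals trigo.

Set Implicit Arguments.
Unset Strict Implicit.
Unset Printing Implicit Defensive.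

Import Order.TTheory GRing.Theory Num.Theory.
Local Open Scope ring_scope.

(* A real diagonal matrix is given by the row vector of its diagonal entries,
   and a linear combination of the coordinate functions eps_0, ..., eps_l by the
   column vector of its coefficients.  Linear combinations of roots have
   coefficients of sum 0, and two such combinations agree as functionals on
   traceless diagonal matrices iff their columns are equal. *)

(* (i, j) is the root eps_i - eps_j of sl_{l+1} *)
Definition rootA (l : nat) := {ij : 'I_l.+1 * 'I_l.+1 | ij.1 != ij.2}.

Section RootSystem.
Variables (R : realType) (l : nat).
Implicit Types (x y : 'rV[R]_l.+1) (a b : rootA l) (s w : 'S_l.+1).
Implicit Types (V : {vspace 'rV[R]_l.+1}) (P : {set rootA l}).

Definition rootv a : 'cV[R]_l.+1 :=
  delta_mx (val a).1 0 - delta_mx (val a).2 0.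

Definition coroot a : 'rV[R]_l.+1 :=
  delta_mx 0 (val a).1 - delta_mx 0 (val a).2.

Definition pairing x a : R := (x *m rootv a) 0 0.

(* The span of all coroots is the span of the simple ones, whatever the choice
   of simple roots. *)
Definition hR : {vspace 'rV[R]_l.+1} := <<[seq coroot a | a : rootA l]>>%VS.

Lemma pairingE x a : pairing x a = x 0 (val a).1 - x 0 (val a).2.
Proof.
rewrite /pairing mxE /rootv.
under eq_bigr do rewrite !mxE eqxx !andbT mulrBr.
rewrite sumrB; congr (_ - _).
- by rewrite (bigD1 (val a).1) //= eqxx mulr1 big1 ?addr0 // => i /negPf ->;
  rewrite mulr0.
- by rewrite (bigD1 (val a).2) //= eqxx mulr1 big1 ?addr0 // => i /negPf ->;
  rewrite mulr0.
Qed.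

Lemma mem_hR x : (x \in hR) = (\sum_i x 0 i == 0).
Proof.
apply/idP/eqP => [|x0].
  move/(@coord_span _ _ _ (in_tuple [seq coroot a | a : rootA l])) => ->.
  under eq_bigr do rewrite summxE.
  rewrite exchange_big /= big1 // => k _.
  have /codomP[a ->] : (in_tuple [seq coroot a | a : rootA l])`_k
      \in codom coroot by rewrite mem_nth.
  under eq_bigr do rewrite mxE.
  rewrite -mulr_sumr /coroot.
  under eq_bigr do rewrite !mxE eqxx /=.
  rewrite sumrB.
  have D (j : 'I_l.+1) : \sum_i ((i == j)%:R : R) = 1.
    by rewrite (bigD1 j) //= eqxx big1 ?addr0 // => i /negPf ->.
  by rewrite !D subrr mulr0.
have xE : x = \sum_(i | i != ord0) x 0 i *: (delta_mx 0 i - delta_mx 0 ord0).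
  under eq_bigr do rewrite scalerBr.
  rewrite sumrB -scaler_suml [LHS]row_sum_delta (bigD1 ord0) //= addrC.
  congr (_ + _); rewrite -scaleNr; congr (_ *: _).
  by move/eqP: x0; rewrite (bigD1 ord0) //= addr_eq0 => /eqP.
rewrite xE.
apply: rpred_sum => i i0; apply/rpredZ/memv_span.
apply/codomP; exists (exist (fun ij : 'I_l.+1 * 'I_l.+1 => ij.1 != ij.2) (i, ord0) i0).
by [].
Qed.

(* The trace of ad x \o ad y is taken on gl_{l+1}; since sl_{l+1} is an ideal of
   gl_{l+1}, it is equal to the trace on sl_{l+1}. *)
Definition ad (X Z : 'M[R]_l.+1) : 'M[R]_l.+1 := X *m Z - Z *m X.

Definition killing x y : R :=
  \tr (lin_mx (ad (diag_mx x) \o ad (diag_mx y))).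

Lemma killingE x y :
  killing x y = \sum_i \sum_j (x 0 i - x 0 j) * (y 0 i - y 0 j).
Proof.
rewrite /killing /mxtrace pair_big /=.
rewrite (reindex _ (curry_mxvec_bij _ _)) /=.
apply: eq_bigr => -[i j] _ /=.
rewrite /lin_mx mxE /= -[mxvec _ 0 _]/(mxvec _ _ _) mxvecE /ad.
have -> : vec_mx (delta_mx 0 (mxvec_index i j)) = delta_mx i j :> 'M[R]_l.+1.
  by rewrite -mxvec_delta mxvecK.
have AD (z : 'rV[R]_l.+1) (Z : 'M[R]_l.+1) (u v : 'I_l.+1) :
    (diag_mx z *m Z - Z *m diag_mx z) u v = (z 0 u - z 0 v) * Z u v.
  by rewrite mul_diag_mx mul_mx_diag !mxE mulrBl [Z u v * _]mulrC.
by rewrite !AD mxE !eqxx mulr1.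
Qed.

(* w sends the i-th coordinate vector to the w i-th one. *)
Definition act w x : 'rV[R]_l.+1 := x *m perm_mx w.

Definition refl a : 'S_l.+1 := tperm (val a).1 (val a).2.

Lemma act_refl a x : act (refl a) x = x - pairing x a *: coroot a.
Proof.
apply/rowP => j; rewrite pairingE /act /refl -tpermV -col_permE !mxE.
rewrite !eqxx /=; case: a => -[u v] /= uv.
case: tpermP => [->|->|/eqP/negPf -> /eqP/negPf ->].
- by rewrite eqxx (negPf uv) subr0 mulr1 subKr.
- by rewrite eqxx eq_sym (negPf uv) sub0r mulrN1 opprK addrC subrK.
- by rewrite subr0 mulr0 subr0.
Qed.

(* Composition of operators, the last reflection being applied first, whereas
   (u * v)%g applies u first. *)
Definition reflprod (gs : seq (rootA l)) : 'S_l.+1 :=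
  foldr (fun a w => (w * refl a)%g) 1%g gs.

Definition single_cycle s : Prop :=
  exists i, s i != i /\ forall j, s j != j -> j \in porbit s i.

Definition positive_system P : Prop :=
  exists x, [/\ x \in hR, forall a, pairing x a != 0 &
                P = [set a | 0 < pairing x a]].

Definition simple_roots P : {set rootA l} :=
  [set a in P | [forall b in P, [forall c in P,
                   rootv a != rootv b + rootv c]]].

(* Only the values alpha 1, ..., alpha l matter. *)
Definition simple_numbering P (alpha : nat -> rootA l) : Prop :=
  [/\ uniq [seq alpha i | i <- iota 1 l],
      simple_roots P =i [seq alpha i | i <- iota 1 l] &
      forall v : 'cV[R]_l.+1,
        (exists2 b, b \in P & v = rootv b) <->
        (exists i j, [/\ (1 <= i <= j)%N, (j <= l)%N &
                         v = \sum_(i <= k < j.+1) rootv (alpha k)])].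

(* A line is rotated only by the angle pi; a plane is rotated by theta with
   respect to one of its two orientations. *)
Definition rotates s V (theta : R) : Prop :=
  [/\ \dim V = 1%N, theta = pi & forall v, v \in V -> act s v = - v] \/
  exists u v,
    [/\ \dim V = 2%N, V = <<[:: u; v]>>%VS,
        killing u v = 0 /\ killing u u = killing v v,
        act s u = cos theta *: u + sin theta *: v &
        act s v = - sin theta *: u + cos theta *: v].

(* theta ord0 plays no role. *)
Definition rotation_decomposition s (K : nat)
    (V : 'I_K.+1 -> {vspace 'rV[R]_l.+1}) (theta : 'I_K.+1 -> R) : Prop :=
  [/\ directv (\sum_i V i), (\sum_i V i)%VS = hR,
      (forall x, (x \in V ord0) = (x \in hR) && (act s x == x)),
      (forall i : 'I_K.+1, (0 < i)%N -> 0 < theta i <= pi /\ rotates s (V i) (theta i)) &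
      (forall i j : 'I_K.+1, (0 < i < j)%N -> theta j <= theta i)].

(* The coroot of a is proportional to the vector of hR that the Killing form
   identifies with a. *)
Definition root_orth a V : Prop :=
  forall v, v \in V -> killing (coroot a) v = 0.

Definition Delta_bar (K : nat) (h : 'I_K.+1 -> 'rV[R]_l.+1) (i : 'I_K.+1) :
    {set rootA l} :=
  [set a | (pairing (h i) a != 0) &&
           [forall j : 'I_K.+1, (i < j)%N ==> (pairing (h j) a == 0)]].

(* The indices i with Delta_bar h i != set0 are i_0 < ... < i_M; sums over
   i_r, ..., i_{k-1} are sums over such indices j with i_r <= j < i_k. *)
Definition associated s P : Prop :=
  exists (K : nat) (V : 'I_K.+1 -> {vspace 'rV[R]_l.+1})
         (theta : 'I_K.+1 -> R) (h : 'I_K.+1 -> 'rV[R]_l.+1),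
    [/\ rotation_decomposition s V theta,
        (forall i, h i \in V i /\
           forall a, ~ root_orth a (V i) -> pairing (h i) a != 0),
        (forall i a, a \in Delta_bar h i ->
           forall r : 'I_K.+1, Delta_bar h r != set0 -> (r < i)%N ->
           `|\sum_(j < K.+1 | (r <= j < i)%N && (Delta_bar h j != set0))
                pairing (h j) a| < `|pairing (h i) a|) &
        P = [set a | 0 < pairing (\sum_(j | Delta_bar h j != set0) h j) a]].

End RootSystem.

Arguments hR : clear implicits.

(* a, a + 2, ..., up to b *)
Definition steps2 (a b : nat) : seq nat :=
  [seq i <- iota a (b.+1 - a) | ~~ odd (i - a)].

(* Main.v *)
Require Import Defs.
From mathcomp Require Import all_boot all_order all_algebra all_fingroup.
From mathcomp Require boolp.
From mathcomp Require Import reals trigo.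
From mathcomp Require Import zify ring lra.
Import Order.TTheory GRing.Theory Num.Theory.
Local Open Scope ring_scope.

(** Write the simple roots, up to a common sign, as eps_{x_i} - eps_{x_(i+1)}
for an enumeration x_0, ..., x_l of the coordinates ([positions]); a root is
positive when it leads from an earlier to a later position.  In each of the four
forms the roots gamma_j are the edges of the path through x_0, ..., x_m,
x_(m+p+1), ..., x_l; those of s_1 are every second edge, those of s_2 the
others, and gamma is the edge that jumps over the p coordinates in the middle,
which s fixes ([mem_edges_true], [mem_edges_false]).

Put N = l' + 1, the number of vertices of the path, and place these vertices on
a regular N-gon at the places 0, 1, -1, 2, -2, ... in the order of the path (for
even m with the opposite orientation).  Two consecutive vertices then have
places of constant sum, the constant depending on the parity of the edge, so s_1
and s_2 act as two reflections of the N-gon ([matching_cpos]) and s as its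
rotation by one step.

For such an s the real Fourier transform on Z/N decomposes the span of the
coroots into the fixed vectors and the spans of the waves cos(2 pi k c / N) and
sin(2 pi k c / N), 1 <= k <= N/2, where c is the place: s rotates the k-th one by
2 pi k / N ([rotation_decomposition_waves]).  The smallest angle belongs to
k = 1, the Coxeter plane.  Orthogonal projection of the N-gon to a line in this
plane, in a suitable direction, orders the vertices exactly as the path does,
with the value 0 separating x_m from x_(m+p+1) ([cos_cpos], [rank_low],
[rank_high]).  So one vector of the Coxeter plane separates all coordinates,
except the fixed ones from each other, and puts the fixed ones in the middle; a
fixed vector, scaled down, then orders those, and for the other components
generic vectors do ([associated_waves]). *)

Set Implicit Arguments.
Unset Strict Implicit.
Unset Printing Implicit Defensive.

(* The name is also that of the evaluation of a group action. *)
Local Notation act := Defs.act.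

(** * Generic vectors *)

(** By induction on the list: if h avoids all subspaces but U, and v in V is not
in U, then v + n h is never in U, and each of the other subspaces contains it
for at most one n. *)
Lemma avoid_subspaces (F : numFieldType) (vT : vectType F) (V : {vspace vT})
    (Us : seq {vspace vT}) :
  all (fun U => ~~ (V <= U)%VS) Us ->
  exists2 h, h \in V & all (fun U : {vspace vT} => h \notin U) Us.
Proof.
elim: Us => [_|U Us IH /= /andP[/subvPn[v vV vU] /IH[h hV hUs]]].
  by exists 0; rewrite ?rpred0.
have [hU|hU] := boolP (h \in U); last by exists h; rewrite ?hU.
suff [M HM] : exists M, forall n, (M <= n)%N ->
    all (fun W : {vspace vT} => v + h *+ n \notin W) Us.
  exists (v + h *+ M); first by rewrite rpredD ?rpredMn.
  by rewrite /= HM // andbT rpredDr ?rpredMn.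
elim: Us hUs {IH} => [|W Us IH /= /andP[hW /IH[M HM]]]; first by exists 0%N.
have [[n0 bad]|good] := boolp.EM (exists n, v + h *+ n \in W); last first.
  exists M => n /HM ->; rewrite andbT; apply/negP => bad; apply: good.
  by exists n.
exists (maxn M n0.+1) => n; rewrite geq_max => /andP[/HM -> n0n]; rewrite andbT.
apply: contra hW => bad'.
have : h *+ (n - n0) \in W.
  rewrite (_ : h *+ _ = (v + h *+ n) - (v + h *+ n0)) ?rpredB //.
  by rewrite mulrnBr 1?ltnW // opprD addrACA subrr add0r.
by rewrite -scaler_nat rpredZeq pnatr_eq0 subn_eq0 leqNgt n0n.
Qed.

(** The scaling that makes the leading component dominate. *)
Lemma scale_below (R : realFieldType) (I : finType) (x y : I -> R) :
  exists2 t, 0 < t & forall i, x i != 0 -> t * `|y i| < `|x i|.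
Proof.
pose S := 1 + \sum_i `|y i| / `|x i|.
have S0 : 0 < S by rewrite ltr_wpDr // sumr_ge0 // => i _; rewrite divr_ge0.
exists S^-1 => [|i xi]; first by rewrite invr_gt0.
have x0 : 0 < `|x i| by rewrite normr_gt0.
rewrite mulrC ltr_pdivrMr // mulrC -ltr_pdivrMr //.
rewrite /S (bigD1 i) //= addrCA ltrDl ltr_wpDr //.
by rewrite sumr_ge0 // => j _; rewrite divr_ge0.
Qed.

(** Since the coordinates of a coroot sum to 0, the double sum that computes the
Killing form reduces to the standard scalar product. *)
Lemma killing_coroot (R : realType) (l : nat) (a : rootA l) (v : 'rV[R]_l.+1) :
  killing (coroot R a) v = (2 * l.+1)%:R * pairing v a.
Proof.
have sumx : \sum_i coroot R a 0 i = 0.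
  apply/eqP; rewrite -mem_hR; apply: memv_span.
  by apply/codomP; exists a.
have E i : \sum_j (coroot R a 0 i - coroot R a 0 j) * (v 0 i - v 0 j) =
    l.+1%:R * (coroot R a 0 i * v 0 i) - coroot R a 0 i * \sum_j v 0 j
    + \sum_j coroot R a 0 j * v 0 j.
  transitivity (\sum_j ((coroot R a 0 i * v 0 i + coroot R a 0 j * v 0 j)
      - (coroot R a 0 i * v 0 j + v 0 i * coroot R a 0 j))).
    by apply: eq_bigr => j _; ring.
  rewrite sumrB !big_split /= sumr_const card_ord -!mulr_sumr sumx.
  by rewrite mulr0 addr0 addrAC mulr_natl.
rewrite killingE; under eq_bigr do rewrite E.
rewrite big_split sumrB -mulr_sumr -mulr_suml sumx mul0r subr0.
rewrite sumr_const card_ord /= !mulr_natl -mulrnDr addnn -mul2n; congr (_ *+ _).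
rewrite pairingE.
have D k : \sum_i (delta_mx 0 k : 'rV[R]_l.+1) 0 i * v 0 i = v 0 k.
  rewrite (bigD1 k) //= mxE !eqxx mul1r big1 ?addr0 // => i /negPf ik.
  by rewrite mxE ik andbF mul0r.
under eq_bigr => i _ do rewrite mxE [X in _ + X]mxE mulrBl.
by rewrite sumrB !D.
Qed.

Lemma pairing0_root_orth (R : realType) (l : nat) (a : rootA l) (V : {vspace 'rV[R]_l.+1}) :
  (forall v, v \in V -> pairing v a = 0) -> root_orth a V.
Proof. by move=> H v /H va; rewrite killing_coroot va mulr0. Qed.

Lemma exists_generic (R : realType) (l : nat) (V : {vspace 'rV[R]_l.+1}) :
  exists h, h \in V /\ forall a, ~ root_orth a V -> pairing h a != 0.
Proof.
pose U (a : rootA l) := lker (linfun (mulmxr (rootv R a) : 'rV[R]_l.+1 -> 'rV[R]_1)).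
have UE v a : (v \in U a) = (pairing v a == 0).
  rewrite memv_ker lfunE /= /pairing; apply/eqP/eqP => [->|E]; first by rewrite mxE.
  by apply/rowP => j; rewrite ord1 E mxE.
have [|h hV hU] := @avoid_subspaces _ _ V [seq U a | a <- enum {: rootA l} & ~~ (V <= U a)%VS].
  by apply/allP => W /mapP[a]; rewrite mem_filter => /andP[aV _] ->.
exists h; split=> // a aV; rewrite -UE; apply: (allP hU); apply: map_f.
rewrite mem_filter mem_enum andbT; apply/negP => sub; apply: aV.
by apply: pairing0_root_orth => v /(subvP sub); rewrite UE => /eqP.
Qed.

(** * The eigenplanes of a cycle *)

Section Waves.
Variables (R : realType) (l N : nat) (s : 'S_l.+1) (D : {set 'I_l.+1}).
(* The permutation s is an N-cycle on D; c x is the place of x in the cycle, and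
   matters modulo N only. *)
Variable c : 'I_l.+1 -> nat.
Hypotheses (N_gt1 : (1 < N)%N).
Hypotheses (c_inj : {in D &, forall i j, c i = c j %[mod N] -> i = j}).
Hypotheses (sD : forall j, (s j \in D) = (j \in D)).
Hypotheses (sC : forall j, j \notin D -> s j = j).
Hypotheses (c_step : forall j, j \in D -> c (s j) = (c j + 1)%N %[mod N]).
Implicit Types (x y : 'rV[R]_l.+1).

Let N_gt0 : (0 < N)%N. Proof. exact: ltnW. Qed.

Lemma sinD_mulpi (a : R) n : sin (a + pi * n%:R) = (-1) ^+ n * sin a.
Proof. by rewrite mulr_natr (alternatingn (@sinDpi R)). Qed.

Lemma cosD_mul2pi (a : R) n : cos (a + pi *+ 2 * n%:R) = cos a.
Proof. by rewrite [pi *+ 2 * _]mulr_natr (periodicn (@cosD2pi R)). Qed.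

Definition omega : R := pi *+ 2 / N%:R.

Let N_neq0 : N%:R != 0 :> R.
Proof. by rewrite pnatr_eq0 -lt0n. Qed.

Lemma omegaN : omega * N%:R = pi *+ 2.
Proof. by rewrite /omega mulfVK // N_neq0. Qed.

Lemma cos_modN k n1 n2 (phi : R) : n1 = n2 %[mod N] ->
  cos (k%:R * omega * n1%:R + phi) = cos (k%:R * omega * n2%:R + phi).
Proof.
have H n : cos (k%:R * omega * n%:R + phi) = cos (k%:R * omega * (n %% N)%:R + phi).
  rewrite -(cosD_mul2pi (_ * (n %% N)%:R + _) (k * (n %/ N))) -omegaN.
  by congr cos; rewrite {1}(divn_eq n N) natrD !natrM; ring.
by move=> eqn; rewrite H eqn -H.
Qed.

(** Multiplication by 2 sin (theta / 2) makes the sum telescope. *)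
Lemma sum_cos_arith (theta : R) n :
  sin (theta / 2) *+ 2 * \sum_(k < n) cos (k%:R * theta) =
  sin (n%:R * theta - theta / 2) + sin (theta / 2).
Proof.
elim: n => [|n IHn]; first by rewrite big_ord0 mulr0 mul0r sub0r sinN addNr.
rewrite big_ord_recr /= mulrDr IHn.
have -> : n.+1%:R * theta - theta / 2 = n%:R * theta + theta / 2.
  by rewrite -natr1; field.
by rewrite sinB sinD mulr2n; ring.
Qed.

(** The orthogonality relation of the characters of Z/N. *)
Lemma sum_cos_roots n1 n2 : (n1 <> n2 %[mod N]) ->
  \sum_(k < N) cos (k%:R * (omega * (n1%:R - n2%:R))) = 0 :> R.
Proof.
wlog le12 : n1 n2 / (n1 <= n2)%N => [IH|].
  case/orP: (leq_total n1 n2) => [/IH//|le21] ne.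
  rewrite -[RHS](IH n2 n1) //; last by move=> /esym.
  by apply: eq_bigr => k _; rewrite -cosN; congr cos; ring.
move=> ne; set d := (n2 - n1)%N.
have dE : n1%:R - n2%:R = - d%:R :> R by rewrite natrB // opprB.
have dN : (0 < d %% N)%N.
  rewrite lt0n; apply/eqP => d0; apply: ne.
  by rewrite -[n2 in RHS](subnK le12) -modnDml d0.
rewrite dE; under eq_bigr do rewrite mulrN mulrN cosN.
(* The telescoped right-hand side vanishes, because N omega = 2 pi, and
   sin (pi d / N) does not, because N does not divide d. *)
have := sum_cos_arith (omega * d%:R) N.
rewrite mulrA [N%:R * _]mulrC omegaN [pi *+ 2 * _]mulr_natr.
rewrite [pi *+ 2 *+ d - _]addrC (periodicn (@sinD2pi R)) sinN addNr => /eqP.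
rewrite mulf_eq0 mulrn_eq0 /= => /orP[/eqP s0|/eqP //].
exfalso; move: s0.
have -> : omega * d%:R / 2 = pi * (d %% N)%:R / N%:R + pi * (d %/ N)%:R.
  rewrite {1}(divn_eq d N) natrD natrM /omega mulr2n.
  by field; rewrite N_neq0.
rewrite sinD_mulpi => /eqP; rewrite mulf_eq0 signr_eq0 /=.
rewrite gt_eqF //; apply: sin_gt0_pi.
have N0 : 0 < N%:R :> R by rewrite ltr0n N_gt0.
rewrite divr_gt0 ?mulr_gt0 ?pi_gt0 ?ltr0n ?N_gt0 //=.
by rewrite ltr_pdivrMr // ltr_pM2l ?pi_gt0 // ltr_nat ltn_mod N_gt0.
Qed.

(** With a free phase, the rotation of the planes is just a shift of the phase. *)
Definition wave (k : nat) (phi : R) : 'rV[R]_l.+1 :=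
  \row_j if j \in D then cos (k%:R * omega * (c j)%:R + phi) else 0.

(** The second generator is the sine wave: cos (x - pi / 2) = sin x.  For k = N / 2
it is 0 and the space is a line. *)
Definition wavesp k : {vspace 'rV[R]_l.+1} :=
  <<[:: wave k 0; wave k (- (pi / 2))]>>%VS.

Lemma actE (w : 'S_l.+1) x j : act w x 0 (w j) = x 0 j.
Proof. by rewrite /act -{1}[w]invgK -col_permE mxE permK. Qed.

Lemma act_inj_rowP (w : 'S_l.+1) x y : (forall j, x 0 j = y 0 (w j)) -> act w x = y.
Proof.
by move=> E; apply/rowP => j; rewrite -[j](permKV w) actE E.
Qed.

Lemma act_wave k phi : act s (wave k phi) = wave k (phi - k%:R * omega).
Proof.
apply: act_inj_rowP => j; rewrite !mxE sD; case: ifP => // jD.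
rewrite (cos_modN k _ (c_step jD)); congr cos.
by rewrite natrD; ring.
Qed.

Lemma waveE k phi :
  wave k phi = cos phi *: wave k 0 - sin phi *: wave k (- (pi / 2)).
Proof.
apply/rowP => j; rewrite !mxE; case: ifP => _; last by rewrite !mulr0 subr0.
by rewrite addr0 cosBpihalf cosD mulrC [sin phi * _]mulrC.
Qed.

Lemma wave_sp k phi : wave k phi \in wavesp k.
Proof.
rewrite waveE; apply: rpredB; apply/rpredZ/memv_span;
by rewrite !inE eqxx ?orbT.
Qed.

Lemma waveNk k phi : (k <= N)%N -> wave (N - k) phi = wave k (- phi).
Proof.
move=> kN; apply/rowP => j; rewrite !mxE; case: ifP => _ //.
rewrite natrB // -[RHS]cosN -[RHS](cosD_mul2pi _ (c j)) -omegaN.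
by congr cos; ring.
Qed.

Lemma wavespNk k : (k <= N)%N -> (wavesp (N - k) <= wavesp k)%VS.
Proof.
by move=> kN; apply/span_subvP => x; rewrite !inE => /orP[] /eqP ->;
  rewrite waveNk // wave_sp.
Qed.

Lemma sum_act (w : 'S_l.+1) x : \sum_j act w x 0 j = \sum_j x 0 j.
Proof.
by rewrite (reindex_inj (@perm_inj _ w)); apply: eq_bigr => j _; rewrite actE.
Qed.

Lemma killing_act (w : 'S_l.+1) x y : killing (act w x) (act w y) = killing x y.
Proof.
rewrite !killingE (reindex_inj (@perm_inj _ w)); apply: eq_bigr => i _.
by rewrite (reindex_inj (@perm_inj _ w)); apply: eq_bigr => j _; rewrite !actE.
Qed.

Lemma killing_bilin (a b a' b' : R) x y :
  killing (a *: x + b *: y) (a' *: x + b' *: y) =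
  a * a' * killing x x + (a * b' + b * a') * killing x y + b * b' * killing y y.
Proof.
rewrite !killingE !mulr_sumr -!big_split; apply: eq_bigr => i _ /=.
rewrite !mulr_sumr -!big_split; apply: eq_bigr => j _ /=.
by rewrite !mxE; ring.
Qed.

(** An isometry that acts on u, v by a rotation matrix with nonzero sine leaves
no choice: invariance of the Gram matrix of u and v forces it to be scalar. *)
Lemma rotation_killing (theta : R) (u v : 'rV[R]_l.+1) : sin theta != 0 ->
  act s u = cos theta *: u + sin theta *: v ->
  act s v = - sin theta *: u + cos theta *: v ->
  killing u v = 0 /\ killing u u = killing v v.
Proof.
move=> sn su sv.
have := killing_act s u u; have := killing_act s u v.
rewrite su sv !killing_bilin; have := cos2Dsin2 theta.
move: (cos _) (sin _) sn (killing u u) (killing u v) (killing v v).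
move=> c0 s0 sn A B C cs E1 E2.
have E3 : s0 * (s0 * (C - A) + 2 * c0 * B) = 0.
  by rewrite -[RHS](subrr A) -[X in _ = _ - X]mul1r
    -[X in _ = _ - X * _]cs -[X in _ = X - _]E2; ring.
have E4 : s0 * (c0 * (C - A) - 2 * s0 * B) = 0.
  by rewrite -[RHS](subrr B) -[X in _ = _ - X]mul1r
    -[X in _ = _ - X * _]cs -[X in _ = X - _]E1; ring.
have {}E3 : s0 * (C - A) + 2 * c0 * B = 0.
  by apply/eqP; move/eqP: E3; rewrite mulf_eq0 (negPf sn).
have {}E4 : c0 * (C - A) - 2 * s0 * B = 0.
  by apply/eqP; move/eqP: E4; rewrite mulf_eq0 (negPf sn).
(* Two linear equations in C - A and 2 B, whose determinant is
   - (cos ^ 2 + sin ^ 2) = - 1. *)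
have B0 : 2 * B = (c0 ^+ 2 + s0 ^+ 2) * (2 * B) by rewrite cs mul1r.
have C0 : C - A = (c0 ^+ 2 + s0 ^+ 2) * (C - A) by rewrite cs mul1r.
have {}B0 : 2 * B = c0 * (s0 * (C - A) + 2 * c0 * B) - s0 * (c0 * (C - A) - 2 * s0 * B).
  by rewrite [LHS]B0; ring.
have {}C0 : C - A = s0 * (s0 * (C - A) + 2 * c0 * B) + c0 * (c0 * (C - A) - 2 * s0 * B).
  by rewrite [LHS]C0; ring.
rewrite E3 E4 !mulr0 subr0 addr0 in B0 C0.
split; last by apply/eqP; rewrite eq_sym -subr_eq0 C0.
by apply/eqP; move/eqP: B0; rewrite mulf_eq0 pnatr_eq0.
Qed.

Lemma omega_gt0 : 0 < omega.
Proof. by rewrite divr_gt0 ?ltr0n ?N_gt0 // mulrn_wgt0 // pi_gt0. Qed.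

Lemma angle_gt0_lepi k : (0 < k <= N./2)%N -> 0 < k%:R * omega <= pi.
Proof.
case/andP=> k0 kN; have N0 : 0 < N%:R :> R by rewrite ltr0n N_gt0.
rewrite mulr_gt0 ?omega_gt0 ?ltr0n //=.
rewrite /omega mulrA ler_pdivrMr // -[pi *+ 2]mulr_natl mulrA -natrM mulrC.
by rewrite ler_pM2l ?pi_gt0 // ler_nat; lia.
Qed.

Lemma angle_ltpi k : (0 < k)%N -> (k * 2 < N)%N -> 0 < k%:R * omega < pi.
Proof.
move=> k0 kN; have N0 : 0 < N%:R :> R by rewrite ltr0n N_gt0.
rewrite mulr_gt0 ?omega_gt0 ?ltr0n //=.
rewrite /omega mulrA ltr_pdivrMr // -[pi *+ 2]mulr_natl mulrA -natrM mulrC.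
by rewrite ltr_pM2l ?pi_gt0 // ltr_nat.
Qed.

Lemma act_wave_cos k :
  act s (wave k 0) =
  cos (k%:R * omega) *: wave k 0 + sin (k%:R * omega) *: wave k (- (pi / 2)).
Proof. by rewrite act_wave sub0r waveE cosN sinN scaleNr opprK. Qed.

Lemma act_wave_sin k :
  act s (wave k (- (pi / 2))) =
  - sin (k%:R * omega) *: wave k 0 + cos (k%:R * omega) *: wave k (- (pi / 2)).
Proof.
rewrite act_wave waveE -opprD cosN sinN scaleNr opprK.
by rewrite [pi / 2 + _]addrC cosDpihalf sinDpihalf.
Qed.

Lemma wavespP k x : x \in wavesp k ->
  exists a b, x = a *: wave k 0 + b *: wave k (- (pi / 2)).
Proof.
rewrite /wavesp span_cons span_seq1 => /memv_addP[_ /vlineP[a ->]].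
by case=> _ /vlineP[b ->] ->; exists a, b.
Qed.

Lemma sum_lin (a b : R) x y :
  \sum_j (a *: x + b *: y) 0 j = a * \sum_j x 0 j + b * \sum_j y 0 j.
Proof. by rewrite !mulr_sumr -big_split; apply: eq_bigr => j _; rewrite !mxE. Qed.

(** The sums of the coordinates of the two waves are invariant under s, so they
form a vector fixed by a rotation of angle other than 0. *)
Lemma wavesp_hR k : (0 < k <= N./2)%N -> (wavesp k <= hR R l)%VS.
Proof.
move=> /angle_gt0_lepi /andP[t0 tpi].
have := sum_act s (wave k 0); have := sum_act s (wave k (- (pi / 2))).
rewrite act_wave_cos act_wave_sin !sum_lin.
set A := \sum_j wave k 0 0 j; set B := \sum_j wave k _ 0 j => E1 E2.
have c1 : cos (k%:R * omega) < 1.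
  by rewrite -[X in _ < X]cos0 ltr_cos ?in_itv //= ?lexx ?pi_ge0 ?(ltW t0) ?tpi.
have := cos2Dsin2 (k%:R * omega); move: (cos _) (sin _) c1 E1 E2 => c0 s0 c1 E1 E2 cs.
have F1 : (c0 - 1) * A + s0 * B = 0 by rewrite mulrBl addrAC E2 mul1r subrr.
have F2 : (c0 - 1) * B - s0 * A = 0.
  by move/eqP: E1; rewrite -subr_eq0 => /eqP <-; ring.
have n0 : 2 * (1 - c0) != 0 by rewrite mulf_neq0 ?pnatr_eq0 // subr_eq0 gt_eqF.
have A0 : A = 0.
  apply: (mulfI n0); rewrite mulr0.
  transitivity ((c0 - 1) * ((c0 - 1) * A + s0 * B) - s0 * ((c0 - 1) * B - s0 * A)).
    rewrite (_ : 2 * (1 - c0) = 1 + 1 - 2 * c0); last by ring.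
    by rewrite -{2}cs; ring.
  by rewrite F1 F2 !mulr0 subr0.
have B0 : B = 0.
  have c0n : c0 - 1 != 0 by rewrite subr_eq0 lt_eqF.
  by apply: (mulfI c0n); rewrite mulr0 -[RHS]F2 A0 mulr0 subr0.
apply/subvP => x /wavespP[a [b ->]].
by rewrite mem_hR sum_lin -/A -/B A0 B0 !mulr0 addr0.
Qed.

(** At any place j of D some combination of the two waves takes the value 1. *)
Lemma wave_neq0 k : D != set0 ->
  ~ (wave k 0 = 0 /\ wave k (- (pi / 2)) = 0).
Proof.
case/set0Pn=> j jD [u0 v0].
have /rowP/(_ j) : wave k (- (k%:R * omega * (c j)%:R)) = 0.
  by rewrite waveE u0 v0 !scaler0 subr0.
by rewrite !mxE jD subrr cos0 => /eqP; rewrite oner_eq0.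
Qed.

Lemma wavesp_rotates k : D != set0 -> (0 < k <= N./2)%N ->
  rotates s (wavesp k) (k%:R * omega).
Proof.
move=> D0 /andP[k0 kN].
have [k2|k2] := ltnP (k * 2) N.
  have /andP[t0 tpi] := angle_ltpi k0 k2.
  have sn : sin (k%:R * omega) != 0 by rewrite gt_eqF // sin_gt0_pi ?t0.
  right; exists (wave k 0), (wave k (- (pi / 2))).
  have su := act_wave_cos k; have sv := act_wave_sin k.
  split=> //; last exact: rotation_killing su sv.
  apply/eqP; rewrite -[2%N]/(size [:: wave k 0; wave k (- (pi / 2))]) -/(free _).
  have v0 : wave k (- (pi / 2)) != 0.
    apply/eqP => v0; apply: (@wave_neq0 k D0); split=> //.
    move/eqP: sv; rewrite v0 scaler0 addr0 /act mul0mx eq_sym scaler_eq0.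
    by rewrite oppr_eq0 (negPf sn) => /eqP.
  (* If u = a v, then the rotation would have a real eigenvector, which
     gives sin theta (1 + a ^ 2) = 0. *)
  rewrite free_cons seq1_free v0 andbT span_seq1; apply/negP => /vlineP[a ua].
  move/eqP: su; rewrite ua /act -scalemxAl -/(act _ _) sv ua.
  rewrite scalerDr !scalerA -!scalerDl -subr_eq0 -scalerBl scaler_eq0 (negPf v0) orbF.
  have -> : a * - sin (k%:R * omega) * a + a * cos (k%:R * omega)
    - (cos (k%:R * omega) * a + sin (k%:R * omega))
    = - (sin (k%:R * omega) * (1 + a ^+ 2)) by ring.
  rewrite oppr_eq0 mulf_eq0 (negPf sn) /= gt_eqF //.
  by rewrite ltr_wpDr ?sqr_ge0.
have kE : (k * 2 = N)%N by lia.
have tE : k%:R * omega = pi.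
  by rewrite /omega -kE natrM mulr2n; field; rewrite pnatr_eq0 -lt0n.
have v0 : wave k (- (pi / 2)) = 0.
  apply/rowP => j; rewrite !mxE tE; case: ifP => // _.
  by rewrite cosBpihalf -[pi * _]add0r sinD_mulpi sin0 mulr0.
have VE : wavesp k = <[wave k 0]>%VS.
  by rewrite /wavesp v0 span_cons span_seq1 addv0.
left; split=> //.
  by rewrite VE dim_vline; case: eqP => // u0; exfalso; apply: (@wave_neq0 k D0); split.
move=> v; rewrite VE => /vlineP[a ->].
by rewrite /act -scalemxAl -/(act _ _) act_wave_cos tE cospi sinpi scale0r addr0 scaleN1r scalerN.
Qed.

Definition dot x y : R := \sum_j x 0 j * y 0 j.

Lemma dotC x y : dot x y = dot y x.
Proof. by apply: eq_bigr => j _; rewrite mulrC. Qed.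

Lemma dot_act (w : 'S_l.+1) x y : dot (act w x) (act w y) = dot x y.
Proof.
by rewrite /dot (reindex_inj (@perm_inj _ w)); apply: eq_bigr => j _; rewrite !actE.
Qed.

Lemma dot_linl (a b : R) x y z : dot (a *: x + b *: y) z = a * dot x z + b * dot y z.
Proof.
by rewrite !mulr_sumr -big_split; apply: eq_bigr => j _; rewrite !mxE /=; ring.
Qed.

(** The operator s + s^-1 is self-adjoint, and its eigenvectors for distinct
eigenvalues are orthogonal; the hypotheses state the eigenvalue equations after
applying s, which avoids the inverse. *)
Lemma eigen_dot (a b : R) x y :
  act s (act s x) + x = (2 * a) *: act s x ->
  act s (act s y) + y = (2 * b) *: act s y -> a != b -> dot x y = 0.
Proof.
move=> Ex Ey ab.
have H (e : R) (z t : 'rV_l.+1) : act s (act s z) + z = (2 * e) *: act s z ->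
    2 * e * dot z t = dot (act s z) t + dot z (act s t).
  move=> Ez; rewrite -(dot_act s z t) -[LHS]addr0 -[X in _ + X](mul0r (dot (act s z) (act s t))).
  rewrite -dot_linl scale0r addr0 -Ez -[act s (act s z)]scale1r -[z in _ + z]scale1r dot_linl.
  by rewrite !mul1r dot_act.
have : 2 * (a - b) * dot x y = 0.
  rewrite mulrBr mulrBl (H _ _ _ Ex) [dot x y]dotC (H _ _ _ Ey).
  by rewrite [dot y _]dotC [dot (act s y) _]dotC [dot x (act s y) + _]addrC subrr.
by move/eqP; rewrite !mulf_eq0 pnatr_eq0 subr_eq0 (negPf ab) => /eqP.
Qed.

Lemma wavesp_eigen k x : x \in wavesp k ->
  act s (act s x) + x = (2 * cos (k%:R * omega)) *: act s x.
Proof.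
have H phi : act s (act s (wave k phi)) + wave k phi =
    (2 * cos (k%:R * omega)) *: act s (wave k phi).
  rewrite !act_wave; apply/rowP => j; rewrite !mxE; case: ifP => _; last by rewrite mulr0 addr0.
  set X := _ * (c j)%:R; set W := k%:R * omega.
  have -> : X + (phi - W - W) = (X + (phi - W)) - W by ring.
  have -> : X + phi = (X + (phi - W)) + W by ring.
  by move: (X + (phi - W)) => Y; rewrite cosB cosD; ring.
have L (e f : R) (z t : 'rV_l.+1) : act s (e *: z + f *: t) = e *: act s z + f *: act s t.
  by rewrite /act mulmxDl -!scalemxAl.
move=> /wavespP[a [b ->]]; rewrite !L addrACA -!scalerDr !H.
by rewrite scalerDr !scalerA [a * _]mulrC [b * _]mulrC.
Qed.

Definition fixsp : {vspace 'rV[R]_l.+1} :=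
  (hR R l :&: fixedSpace (linfun (mulmxr (perm_mx s))))%VS.

Lemma mem_fixsp x : (x \in fixsp) = (x \in hR R l) && (act s x == x).
Proof.
rewrite memv_cap; congr (_ && _).
by apply: (sameP fixedSpaceP); rewrite lfunE; apply: eqP.
Qed.

Lemma dot_self_eq0 x : dot x x = 0 -> x = 0.
Proof.
move/eqP; rewrite psumr_eq0 => [/allP H|j _]; last by rewrite -expr2 sqr_ge0.
apply/rowP => j; have := H j (mem_index_enum _); rewrite -expr2 sqrf_eq0 mxE.
by move/eqP.
Qed.

(** The frequencies decrease with the index, so that the angles do, as the
decomposition requires; frequency 0 stands for the fixed vectors. *)
Definition freq (i : 'I_(N./2).+1) : nat := if i == ord0 then 0 else ((N./2).+1 - i)%N.

Definition decomp (i : 'I_(N./2).+1) : {vspace 'rV[R]_l.+1} :=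
  if i == ord0 then fixsp else wavesp (freq i).

Lemma freq_bounds i : i != ord0 -> (0 < freq i <= N./2)%N.
Proof. by rewrite /freq -val_eqE /= => /[dup] i0 /negPf ->; have := ltn_ord i; lia. Qed.

Lemma freq_inj : injective freq.
Proof.
move=> i j; rewrite /freq -!val_eqE /= => E; apply: val_inj => /=.
have := ltn_ord i; have := ltn_ord j; move: E.
by case: eqP => ?; case: eqP => ?; lia.
Qed.

Lemma decomp_hR i : (decomp i <= hR R l)%VS.
Proof.
rewrite /decomp; case: ifPn => [_|/freq_bounds]; first exact: capvSl.
exact: wavesp_hR.
Qed.

Lemma decomp_eigen i x : x \in decomp i ->
  act s (act s x) + x = (2 * cos ((freq i)%:R * omega)) *: act s x.
Proof.
rewrite /decomp; case: ifPn => [/eqP -> |_]; last exact: wavesp_eigen.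
rewrite mem_fixsp => /andP[_ /eqP sx].
by rewrite !sx /freq eqxx mul0r cos0 mulr1 scaler_nat mulr2n.
Qed.

Lemma cos_freq_inj i j : cos ((freq i)%:R * omega) = cos ((freq j)%:R * omega) -> i = j.
Proof.
have B k : ((freq k)%:R * omega) \in `[0, pi].
  rewrite in_itv /=; have [->|k0] := eqVneq k ord0.
    by rewrite /freq eqxx mul0r lexx pi_ge0.
  by have /andP[/ltW-> ->] := angle_gt0_lepi (freq_bounds k0).
move/(cos_inj (B i) (B j))/mulIf => E; apply: freq_inj; apply/eqP.
by rewrite -(eqr_nat R) E // gt_eqF ?omega_gt0.
Qed.

(** The cosine is injective on the angles of the decomposition, so its members are
eigenspaces for distinct eigenvalues, hence orthogonal. *)
Lemma directv_decomp : directv (\sum_i decomp i).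
Proof.
apply/directv_sum_independent => us usV us0 i _.
apply: dot_self_eq0.
have <- : dot (us i) (\sum_j us j) = dot (us i) (us i).
  transitivity (\sum_j dot (us i) (us j)).
    rewrite /dot exchange_big /=; apply: eq_bigr => k _.
    by rewrite summxE mulr_sumr.
  rewrite (bigD1 i) //= big1 ?addr0 // => j ji.
  apply: (eigen_dot (decomp_eigen (usV i isT)) (decomp_eigen (usV j isT))).
  by apply: contra ji => /eqP/cos_freq_inj ->.
by rewrite us0 /dot big1 // => k _; rewrite mxE mulr0.
Qed.

(** The k-th term of the Fourier expansion of x over Z/N.  The terms for k and
N - k lie in the same plane. *)
Definition harmonic (x : 'rV[R]_l.+1) k : 'rV[R]_l.+1 :=
  N%:R^-1 *: \sum_(j in D) x 0 j *: wave k (- (k%:R * omega * (c j)%:R)).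

Lemma harmonic_sp x k : harmonic x k \in wavesp k.
Proof. by apply/rpredZ/rpred_sum => j _; apply/rpredZ/wave_sp. Qed.

Lemma harmonicE x k i : harmonic x k 0 i =
  if i \in D then
    N%:R^-1 * \sum_(j in D) x 0 j * cos (k%:R * (omega * ((c i)%:R - (c j)%:R)))
  else 0.
Proof.
rewrite mxE summxE; case: ifP => iD.
  congr (_ * _); apply: eq_bigr => j _; rewrite !mxE iD; congr (_ * cos _); ring.
by rewrite big1 ?mulr0 // => j _; rewrite !mxE iD mulr0.
Qed.

(** Fourier inversion. *)
Lemma sum_harmonic x i : i \in D -> \sum_(k < N) harmonic x k 0 i = x 0 i.
Proof.
move=> iD; under eq_bigr do rewrite harmonicE iD.
rewrite -mulr_sumr exchange_big /=; under eq_bigr do rewrite -mulr_sumr.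
rewrite (bigD1 i) //= [X in _ + X]big1 ?addr0; last first.
  move=> j /andP[jD ji]; rewrite sum_cos_roots ?mulr0 // => /(c_inj iD jD) ij.
  by rewrite ij eqxx in ji.
under eq_bigr do rewrite subrr !mulr0 cos0.
by rewrite sumr_const card_ord mulrC -mulrA mulfV ?mulr1 // N_neq0.
Qed.

Lemma wavesp_decomp k : (0 < k < N)%N -> (wavesp k <= \sum_i decomp i)%VS.
Proof.
move=> /andP[k0 kN].
have H k' : (0 < k' <= N./2)%N -> (wavesp k' <= \sum_i decomp i)%VS.
  move=> /andP[k0' kN'].
  have lt : ((N./2).+1 - k' < (N./2).+1)%N by lia.
  have i0 : Ordinal lt != ord0 by rewrite -val_eqE /=; lia.
  rewrite -(_ : decomp (Ordinal lt) = wavesp k'); first exact: (sumv_sup (Ordinal lt)).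
  by rewrite /decomp /freq !(negPf i0) /= subKn //; lia.
have [kK|kK] := leqP k (N./2); first by apply: H; rewrite k0.
rewrite -(subKn (ltnW kN)); apply: subv_trans (H (N - k)%N _); last by lia.
by apply: wavespNk; apply: leq_subr.
Qed.

(** The terms of positive frequency in the Fourier expansion of x are in the
planes; what remains of x is constant on D, hence fixed by s. *)
Lemma sum_decomp : (\sum_i decomp i)%VS = hR R l.
Proof.
apply/eqP; rewrite eqEsubv; apply/andP; split.
  by apply/subv_sumP => i _; apply: decomp_hR.
apply/subvP => x xh; pose w := \sum_(1 <= k < N) harmonic x k.
have wS : w \in (\sum_i decomp i)%VS.
  rewrite /w big_nat; apply: rpred_sum => k kN.
  by apply: (subvP (wavesp_decomp _)) (harmonic_sp x k); rewrite lt0n -lt0n.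
have wh : w \in hR R l.
  apply: (subvP _ _ wS); apply/subv_sumP => i _; apply: decomp_hR.
rewrite -(subrK w x); apply: rpredD => //.
apply: (subvP (sumv_sup ord0 _ (subvv _))) => //.
rewrite /decomp eqxx mem_fixsp rpredB //=; apply/eqP/act_inj_rowP => j.
have wE i : (x - w) 0 i = if i \in D then harmonic x 0 0 i else x 0 i.
  rewrite mxE [X in _ + X]mxE /w summxE; case: ifPn => iD.
    rewrite -[x 0 i](sum_harmonic _ iD) -(big_mkord xpredT (fun k => harmonic x k 0 i)).
    by rewrite big_ltn ?N_gt0 // addrK.
  by rewrite big1 ?subr0 // => k _; rewrite harmonicE (negPf iD).
rewrite !wE sD; case: ifPn => [jD|/sC -> //].
rewrite !harmonicE sD jD; congr (_ * _); apply: eq_bigr => i _.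
by rewrite !mul0r.
Qed.

Lemma rotation_decomposition_waves : D != set0 ->
  rotation_decomposition s decomp (fun i => (freq i)%:R * omega).
Proof.
move=> D0; split.
- exact: directv_decomp.
- exact: sum_decomp.
- by move=> x; rewrite /decomp eqxx mem_fixsp.
- move=> i i0; have n0 : i != ord0 by rewrite -val_eqE /= -lt0n.
  have b := freq_bounds n0; split; first exact: angle_gt0_lepi.
  by rewrite /decomp (negPf n0); apply: wavesp_rotates.
- move=> i j /andP[i0 ij]; rewrite ler_pM2r ?omega_gt0 // ler_nat.
  by rewrite /freq -!val_eqE /=; case: eqP; case: eqP; have := ltn_ord j; lia.
Qed.

Lemma wavesp_off k x j : x \in wavesp k -> j \notin D -> x 0 j = 0.
Proof.
by move=> /wavespP[a [b ->]] /negPf jD; rewrite !mxE jD !mulr0 addr0.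
Qed.

(** The places c + n run through all residues, so s is transitive on D. *)
Lemma fixsp_cst x : x \in fixsp -> {in D &, forall i j, x 0 i = x 0 j}.
Proof.
rewrite mem_fixsp => /andP[_ /eqP sx] i j iD jD.
have x_iter n : x 0 (iter n s j) = x 0 j.
  by elim: n => //= n IHn; rewrite -{1}sx actE.
have iterD n : iter n s j \in D by elim: n => //= n; rewrite sD.
have c_iter n : c (iter n s j) = (c j + n)%N %[mod N].
  elim: n => [|n IHn]; first by rewrite addn0.
  by rewrite /= c_step // -modnDml IHn modnDml -addnA addn1.
rewrite -(x_iter (c i + N.-1 * c j)%N); congr (x 0 _); apply: c_inj => //.
rewrite c_iter addnCA -mulSn prednK ?N_gt0 //.
by rewrite addnC mulnC modnMDl.
Qed.

Lemma freq_max : freq ord_max = 1%N.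
Proof. by rewrite /freq -val_eqE /= subSnn; case: eqP => //; move: N_gt1; lia. Qed.

Lemma max_neq0 : ord_max != ord0 :> 'I_(N./2).+1.
Proof. by rewrite -val_eqE /=; move: N_gt1; lia. Qed.

(** The component of smallest angle is htop and the fixed one is a small multiple
of h0; the others are generic.  Since htop separates every pair of coordinates
with a member in D, only these two components have nonempty sets of roots. *)
Lemma associated_waves (htop h0 : 'rV[R]_l.+1) : D != set0 ->
  htop \in wavesp 1 -> h0 \in fixsp ->
  {in D &, injective (htop 0)} -> {in D, forall j, htop 0 j != 0} ->
  (forall i j, i != j -> i \notin D -> h0 0 i != h0 0 j) ->
  associated R s [set a | if pairing htop a == 0 then 0 < pairing h0 a
                        else 0 < pairing htop a].
Proof.
move=> D0 htW h0F ht_inj ht_neq0 h0_neq.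
have ht_off (a : rootA l) : (pairing htop a == 0) = ((val a).1 \notin D) && ((val a).2 \notin D).
  case: a => -[i j] /= ij; rewrite pairingE /= subr_eq0.
  have [iD|iD] := boolP (i \in D); have [jD|jD] := boolP (j \in D) => /=.
  - by apply: contraNF ij => /eqP /ht_inj ->.
  - by rewrite [htop 0 j](wavesp_off htW) //; apply: negbTE; apply: ht_neq0.
  - by rewrite [htop 0 i](wavesp_off htW) // eq_sym; apply: negbTE; apply: ht_neq0.
  - by rewrite !(wavesp_off htW) // eqxx.
have [t t0 tlt] := scale_below (fun a => pairing htop a) (fun a => pairing h0 a).
have [g gP] := fin_all_exists (fun i => exists_generic (decomp i)).
pose h i := if i == ord0 then t *: h0 else if i == ord_max then htop else g i.
have h_0 : h ord0 = t *: h0 by rewrite /h eqxx.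
have h_max : h ord_max = htop by rewrite /h (negPf max_neq0) eqxx.
have hV i : h i \in decomp i.
  rewrite /h; case: eqP => [->|/eqP i0]; first by rewrite rpredZ // /decomp eqxx.
  case: eqP => [->|_]; last by case: (gP i).
  by rewrite /decomp (negPf max_neq0) freq_max.
have tpair a : pairing (t *: h0) a = t * pairing h0 a.
  by rewrite !pairingE !mxE mulrBr.
have decomp_off i x a : i != ord0 -> x \in decomp i -> pairing htop a = 0 -> pairing x a = 0.
  rewrite /decomp => /negPf -> xW /eqP; rewrite ht_off => /andP[iD jD].
  by rewrite pairingE !(wavesp_off xW) ?subr0.
have h0_off a : pairing htop a = 0 -> pairing h0 a != 0.
  move/eqP; rewrite ht_off => /andP[iD _]; rewrite pairingE subr_eq0.
  by apply: h0_neq => //; case: (a).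
(* A root that htop kills has both coordinates outside D, where all
   components but the fixed one vanish. *)
have bar_off i : Delta_bar h i != set0 -> i = ord0 \/ i = ord_max.
  case/set0Pn=> a; rewrite inE => /andP[ha /forallP/(_ ord_max)/implyP ha'].
  have [|i0] := eqVneq i ord0; [by left | right; apply/eqP; apply: contraNT ha => im].
  have lt : (i < @ord_max N./2)%N by rewrite ltn_neqAle im -ltnS ltn_ord.
  by rewrite (decomp_off i) //; move/eqP: (ha' lt); rewrite h_max.
exists N./2, decomp, (fun i => (freq i)%:R * omega), h; split.
- exact: rotation_decomposition_waves.
- move=> i; split=> // a; rewrite /h; case: (i =P ord0) => [->|/eqP i0].
    rewrite /decomp eqxx tpair => na; rewrite mulf_neq0 ?(gt_eqF t0) //.
    apply/eqP => pa0; apply: na; apply: pairing0_root_orth => v vF.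
    case: a pa0 => -[u w] /= uw; rewrite !pairingE /= => /eqP; rewrite subr_eq0.
    have [uD|uD] := boolP (u \in D); last by rewrite (negPf (h0_neq _ _ uw uD)).
    have [wD|wD] := boolP (w \in D).
      by rewrite (fixsp_cst vF uD wD) subrr.
    by rewrite eq_sym (negPf (h0_neq w u _ wD)) // eq_sym.
  case: (i =P ord_max) => [->|_]; last by case: (gP i) => _; apply.
  move=> na; apply/eqP => pa0; apply: na; apply: pairing0_root_orth => v vV.
  by apply: (decomp_off ord_max) => //; rewrite max_neq0.
- move=> i a ai r r0 ri.
  have i_max : i = ord_max.
    case: (bar_off i) => // [|i0]; first by apply/set0Pn; exists a.
    by rewrite i0 in ri.
  have r_0 : r = ord0 by case: (bar_off r r0) => // rm; move: ri; rewrite rm i_max ltnn.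
  subst i r; rewrite (bigD1 ord0) /=; last first.
    by rewrite r0 andbT lt0n; apply: max_neq0.
  rewrite big1 ?addr0 => [|j /andP[/andP[jm /bar_off[->|jE]]]]; last 2 first.
  + by rewrite eqxx.
  + by move: jm; rewrite jE ltnn.
  rewrite h_0 h_max tpair normrM (gtr0_norm t0); apply: tlt.
  by move: ai; rewrite inE h_max => /andP[].
- apply/setP => a; rewrite !inE.
  have pS : pairing (\sum_(j | Delta_bar h j != set0) h j) a =
      \sum_(j | Delta_bar h j != set0) pairing (h j) a.
    by rewrite /pairing mulmx_suml summxE.
  rewrite pS; case: eqP => [pa0|/eqP pa].
    rewrite (bigD1 ord0) /=; last first.
      apply/set0Pn; exists a; rewrite inE h_0 tpair mulf_neq0 ?h0_off ?(gt_eqF t0) //=.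
      apply/forallP => j; apply/implyP => j0.
      by rewrite (decomp_off j) // -val_eqE /= -lt0n.
    rewrite big1 ?addr0 => [|j /andP[_ j0]]; last exact: (decomp_off j).
    by rewrite h_0 tpair pmulr_rgt0.
  rewrite (bigD1 ord_max) /=; last first.
    apply/set0Pn; exists a; rewrite inE h_max pa /=.
    by apply/forallP => j; rewrite implybE -leqNgt -ltnS ltn_ord.
  rewrite h_max; set X := \sum_(j | _) _.
  have Xlt : `|X| < `|pairing htop a|.
    apply: le_lt_trans (tlt a pa); rewrite /X.
    have [ne|e] := boolP (Delta_bar h ord0 != set0).
      rewrite (bigD1 ord0) /=; last by rewrite ne eq_sym max_neq0.
      rewrite big1 ?addr0 => [|j /andP[/andP[/bar_off[->|->]]]]; rewrite ?eqxx //.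
      by rewrite h_0 tpair normrM (gtr0_norm t0).
    rewrite big1 ?normr0 ?mulr_ge0 ?(ltW t0) // => j /andP[ne jm].
    by case: (bar_off j ne) => jE; move: ne jm; rewrite jE ?eqxx // => ne; rewrite ne in e.
  move: Xlt; case: (ltgtP 0 (pairing htop a)) => [p0|p0|p0] Xlt.
  + by symmetry; move: Xlt; rewrite (gtr0_norm p0) ltr_norml => /andP[? ?]; lra.
  + by symmetry; move: Xlt; rewrite (ltr0_norm p0) ltr_norml => /andP[? ?]; lra.
  + by rewrite -p0 eqxx in pa.
Qed.

End Waves.

(** * The simple roots as a path *)

Section Chain.
Variables (R : realType) (l : nat).
Implicit Types (a e : rootA l) (b : bool).

(** A numbering of the simple roots and the reversed numbering satisfy the same
axioms.  The boolean b allows for both: when it is false, roots are read from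
their second coordinate to the first. *)
Definition src b a := if b then (val a).1 else (val a).2.
Definition dst b a := if b then (val a).2 else (val a).1.

Lemma src_neq_dst b a : src b a != dst b a.
Proof. by case: a b => -[u v] /= uv [] //; rewrite eq_sym. Qed.

Definition edgev (x y : 'I_l.+1) : 'cV[R]_l.+1 := delta_mx x 0 - delta_mx y 0.

Lemma edgevE x y k : edgev x y k 0 = (k == x)%:R - (k == y)%:R.
Proof. by rewrite !mxE !andbT. Qed.

Definition sg b : R := if b then 1 else -1.

Lemma rootv_edge b a : rootv R a = sg b *: edgev (src b a) (dst b a).
Proof. by case: b; rewrite ?scale1r ?scaleN1r ?opprB. Qed.

Lemma sg_neq0 b : sg b != 0.
Proof. by case: b; rewrite ?oppr_eq0 oner_eq0. Qed.

Lemma edgev_inj x y u v : u != v -> edgev x y = edgev u v -> x = u /\ y = v.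
Proof.
move=> uv /matrixP E.
have Eu : (u == x)%:R - (u == y)%:R = 1 :> R.
  by have := E u 0; rewrite !edgevE eqxx (negPf uv) subr0.
have Ev : (v == x)%:R - (v == y)%:R = -1 :> R.
  by have := E v 0; rewrite !edgevE eqxx [v == u]eq_sym (negPf uv) sub0r.
split; apply/esym; [move: Eu | move: Ev]; clear.
  by case: (u =P x) => // _; case: (u == y) => /= H; exfalso; lra.
by case: (v =P y) => // _; case: (v == x) => /= H; exfalso; lra.
Qed.

Lemma edgev_chain x y v : edgev x y + edgev y v = edgev x v.
Proof. by rewrite /edgev addrA subrK. Qed.

Lemma edgev_add x y u v z w : x != y -> u != v -> z != w ->
  edgev x y + edgev u v = edgev z w ->
  (y = u /\ z = x /\ w = v) \/ (x = v /\ z = u /\ w = y).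
Proof.
move=> xy uv zw E.
have [yu|yu] := eqVneq y u.
  left; split=> //; apply: edgev_inj; last by rewrite -E yu edgev_chain.
  apply/eqP => xv; move/eqP: zw; apply; move: E; rewrite yu xv edgev_chain.
  move/matrixP/(_ z 0); rewrite !edgevE subrr eqxx.
  by case: (z =P w) => // _; rewrite subr0 => /esym/eqP; rewrite oner_eq0.
have Ey : - 1 - (y == v)%:R = (y == z)%:R - (y == w)%:R :> R.
  have /matrixP/(_ y 0) := E; rewrite mxE !edgevE eqxx (negPf yu).
  by rewrite [y == x]eq_sym (negPf xy) !sub0r.
have wy : w = y.
  move: Ey; clear; case: (y =P w) => // _.
  by case: (y == v); case: (y == z) => /= H; exfalso; lra.
have zu : z = u.
  have /matrixP/(_ u 0) := E; rewrite !edgevE mxE !edgevE eqxx (negPf uv) [u == y]eq_sym (negPf yu) wy.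
  rewrite [u == y]eq_sym (negPf yu); clear; case: (u =P z) => // _.
  by case: (u == x) => /= H; exfalso; lra.
right; split=> //; have : edgev x v = 0.
  have -> : edgev x v = edgev x y + edgev u v - edgev u y.
    by apply/matrixP => i j; rewrite !mxE; ring.
  by rewrite E zu wy subrr.
move/matrixP/(_ v 0); rewrite edgevE mxE eqxx; case: (v =P x) => // _ /eqP.
by rewrite sub0r oppr_eq0 oner_eq0.
Qed.

Lemma root_add b a a' e : rootv R a + rootv R a' = rootv R e ->
  (dst b a = src b a' /\ src b e = src b a /\ dst b e = dst b a') \/
  (src b a = dst b a' /\ src b e = src b a' /\ dst b e = dst b a).
Proof.
rewrite !(rootv_edge b) -scalerDr => /(scalerI (sg_neq0 b)).
exact: edgev_add (src_neq_dst b a) (src_neq_dst b a') (src_neq_dst b e).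
Qed.

Variables (P : {set rootA l}) (alpha : nat -> rootA l).
Hypothesis numb : simple_numbering R P alpha.

Let v k := rootv R (alpha k).

Lemma interval_root i j : (1 <= i <= j)%N -> (j <= l)%N ->
  exists2 e, e \in P & \sum_(i <= k < j.+1) v k = rootv R e.
Proof.
case: numb => _ _ H ij jl; apply/H; by exists i, j.
Qed.

(** Let e = alpha_i + alpha_(i+1).  As alpha_(i+1) + alpha_(i+2) is a root, these
two are linked in one direction or the other.  In the wrong direction, the root
e + alpha_(i+2) could only be formed if alpha_i were a loop. *)
Lemma link_succ b i : (1 <= i)%N -> (i.+2 <= l)%N ->
  dst b (alpha i) = src b (alpha i.+1) -> dst b (alpha i.+1) = src b (alpha i.+2).
Proof.
move=> i1 il link.
have [e _ eE] := @interval_root i i.+1 ltac:(lia) ltac:(lia).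
have [f _ fE] := @interval_root i i.+2 ltac:(lia) ltac:(lia).
have [g _ gE] := @interval_root i.+1 i.+2 ltac:(lia) ltac:(lia).
have S2 k : \sum_(k <= h < k.+2) v h = v k + v k.+1.
  by rewrite big_nat_recr ?leqW //= big_nat1.
have {}fE : rootv R e + rootv R (alpha i.+2) = rootv R f.
  by rewrite -eE -fE [RHS]big_nat_recr //= ltnW.
rewrite S2 in eE; rewrite S2 in gE.
case: (root_add b gE) => [[-> //]|[E _]].
case: (root_add b eE) => [[_ [e1 e2]]|[_ [e1 e2]]]; last first.
  by have := src_neq_dst b e; rewrite e1 e2 link eqxx.
case: (root_add b fE) => [[<- _]|[F _]]; first by rewrite e2.
by have := src_neq_dst b (alpha i); rewrite link E -F e1 eqxx.
Qed.

Lemma links : exists b, forall i, (1 <= i)%N -> (i < l)%N ->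
  dst b (alpha i) = src b (alpha i.+1).
Proof.
have H b : dst b (alpha 1%N) = src b (alpha 2%N) ->
    forall i, (1 <= i)%N -> (i < l)%N -> dst b (alpha i) = src b (alpha i.+1).
  move=> H1; elim=> // -[|i] IH _ il; first exact: H1.
  by apply: link_succ => //; apply: IH => //; apply: ltnW.
have [l1|l1] := leqP l 1; first by exists true => i i1 il; lia.
have [e _] := @interval_root 1 2 isT l1.
rewrite big_nat_recr //= big_nat1 => /(root_add true)[[E _]|[E _]].
  by exists true; apply: H.
by exists false; apply: H.
Qed.

(** The sums over intervals telescope along the chain of simple roots, and they
are roots, hence nonzero; so the l + 1 vertices of the chain are distinct, and
they exhaust the coordinates. *)
Lemma positions : (0 < l)%N -> exists b (pos : 'I_l.+1 -> 'I_l.+1),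
  [/\ injective pos,
      forall a i j, (i < j <= l)%N ->
        rootv R a = \sum_(i.+1 <= k < j.+1) rootv R (alpha k) ->
        pos (src b a) = i :> nat /\ pos (dst b a) = j :> nat &
      P = [set a | (pos (src b a) < pos (dst b a))%N]].
Proof.
move=> l0; have [b link] := links.
pose tau i := if i == 0%N then src b (alpha 1%N) else dst b (alpha i).
have vE i : (i < l)%N -> v i.+1 = sg b *: edgev (tau i) (tau i.+1).
  rewrite /v (rootv_edge b) /tau /=; case: eqP => [->//|/eqP]; rewrite -lt0n => i0 il.
  by rewrite (link i).
have sumE i n : (i + n.+1 <= l)%N ->
    \sum_(i.+1 <= k < (i + n.+1).+1) v k = sg b *: edgev (tau i) (tau (i + n.+1)%N).
  elim: n => [|n IH] le; first by rewrite addn1 big_nat1 vE // -addn1.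
  rewrite addnS in le *; rewrite big_nat_recr /=; last by rewrite ltnS; lia.
  by rewrite IH ?(ltnW le) // vE // -scalerDr edgev_chain.
have sumE' i j : (i < j <= l)%N ->
    \sum_(i.+1 <= k < j.+1) v k = sg b *: edgev (tau i) (tau j).
  by move=> /andP[ij jl]; have := @sumE i (j - i.+1)%N; rewrite addnS -addSn subnKC //; apply.
have ends a i j : (i < j <= l)%N -> rootv R a = \sum_(i.+1 <= k < j.+1) v k ->
    tau i = src b a /\ tau j = dst b a.
  move=> ij; rewrite sumE' // (rootv_edge b) => /(scalerI (sg_neq0 b)) /esym.
  exact/edgev_inj/src_neq_dst.
have tau_neq i j : (i < j <= l)%N -> tau i != tau j.
  move=> /[dup] ij /andP[lt jl]; have [||e _ /esym eE] := @interval_root i.+1 j => //.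
  by have [-> ->] := ends e i j ij eE; apply: src_neq_dst.
have tau_inj : injective (fun i : 'I_l.+1 => tau i).
  move=> i j E; apply: val_inj => /=; have := ltn_ord i; have := ltn_ord j.
  rewrite !ltnS => jl il; case: (ltngtP i j) => // ij.
    by have := tau_neq i j; rewrite ij jl E eqxx => /(_ isT).
  by have := tau_neq j i; rewrite ij il E eqxx => /(_ isT).
pose pos := (perm tau_inj)^-1%g.
have posK i : (i <= l)%N -> pos (tau i) = i :> nat.
  move=> il; have -> : tau i = perm tau_inj (inord i) by rewrite permE inordK.
  by rewrite permK inordK.
have tauK x : tau (pos x) = x by rewrite -[RHS](permKV (perm tau_inj)) permE.
exists b, pos; split; first exact: perm_inj.
  move=> a i j ij /(ends _ _ _ ij) [<- <-]; case/andP: ij => ij jl.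
  by rewrite !posK // ltnW // (leq_trans ij).
apply/setP => a; rewrite inE; case: numb => _ _ H.
apply/idP/idP => [aP|lt].
  have [] := (H (rootv R a)).1; first by exists a.
  move=> [|i] [j [//= ij jl aE]]; have [] := ends a i j _ aE; first by rewrite ij.
  by move=> <- <-; rewrite !posK // ltnW // (leq_trans ij).
have [||e eP eE] := @interval_root (pos (src b a)).+1 (pos (dst b a)); rewrite ?lt //.
  by rewrite -ltnS ltn_ord.
rewrite -[a](_ : e = a) //.
have := ends e (pos (src b a)) (pos (dst b a)); rewrite lt -ltnS ltn_ord.
move=> /(_ isT (esym eE)); rewrite !tauK => -[E1 E2].
apply: val_inj; rewrite [val e]surjective_pairing [val a]surjective_pairing.
by case: (b) E1 E2; rewrite /src /dst /= => -> ->.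
Qed.

End Chain.

(** * Products of disjoint reflections *)

Section Reflections.
Variable l : nat.
Implicit Types (a : rootA l) (gs : seq (rootA l)).

Definition meets a x := (x == (val a).1) || (x == (val a).2).

Lemma meets_ends b a : meets a (src b a) /\ meets a (dst b a).
Proof. by case: b; rewrite /meets !eqxx ?orbT. Qed.

Lemma refl_src b a : refl a (src b a) = dst b a.
Proof. by case: b; rewrite /refl ?tpermL ?tpermR. Qed.

Lemma refl_dst b a : refl a (dst b a) = src b a.
Proof. by case: b; rewrite /refl ?tpermL ?tpermR. Qed.

Lemma refl_out a x : ~~ meets a x -> refl a x = x.
Proof. by rewrite negb_or /refl => /andP[x1 x2]; rewrite tpermD // eq_sym. Qed.

Definition disjoint_roots gs :=
  {in gs &, forall a a' x, meets a x -> meets a' x -> a = a'}.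

Lemma reflprod_out gs x : {in gs, forall a, ~~ meets a x} -> reflprod gs x = x.
Proof.
elim: gs => [|a gs IH] H /=; first by rewrite perm1.
rewrite permM IH ?refl_out ?H ?mem_head // => a' a'gs.
by apply: H; rewrite inE a'gs orbT.
Qed.

Lemma reflprod_in gs a x : uniq gs -> disjoint_roots gs -> a \in gs ->
  meets a x -> reflprod gs x = refl a x.
Proof.
elim: gs => [|a0 gs IH] //= /andP[a0gs ugs] dis; rewrite inE => /orP[/eqP ->|ags] ax.
  rewrite permM reflprod_out // => a' a'gs; apply/negP => a'x.
  move: a0gs; rewrite (dis a0 a' _ _ x) ?a'gs ?mem_head //.
  by rewrite inE a'gs orbT.
have dis' : disjoint_roots gs.
  by move=> u w ugs' wgs; apply: dis; rewrite inE ?ugs' ?wgs orbT.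
rewrite permM (IH ugs dis' ags ax) refl_out //; apply/negP => bad.
have ax' : meets a (refl a x).
  by case/orP: ax => /eqP ->; rewrite /refl ?tpermL ?tpermR /meets eqxx ?orbT.
by move: a0gs; rewrite (dis a0 a _ _ _ bad ax') ?mem_head ?ags // inE ags orbT.
Qed.
End Reflections.

(** * Two reflections of a polygon *)

Section CyclePosition.
Variables m N : nat.

(** The place on the N-gon of the q-th vertex of the path: 0, 1, -1, 2, -2, ...
modulo N for odd m, with opposite signs for even m.  Only for q = 0 and odd m is
the value N itself taken instead of 0. *)
Definition cpos q := if odd q (+) odd m then (N - uphalf q)%N else uphalf q.

(** A reflection of the N-gon is given by the constant sum of a place and its
image.  The sums for the two reflections, with e = true for s_1, differ by 1. *)
Definition kap (e : bool) := (N - ~~ odd m + e)%N.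

Lemma uphalf_dbl q : ((uphalf q).*2 = q + odd q)%N.
Proof.
have := odd_double_half q; rewrite uphalf_half.
by case: (odd q) => /=; move: q./2 => h; lia.
Qed.

Lemma cpos_edge q : (q.+1 < N)%N ->
  (cpos q + cpos q.+1)%N = kap (odd q (+) odd m).
Proof.
have := uphalf_dbl q; have := uphalf_dbl q.+1; rewrite /cpos /kap /=.
move: (uphalf q) (half q).+1 => u u'.
by case: (odd m); case: (odd q) => /=; lia.
Qed.

(** An end of the path that no edge of the given parity meets is a fixed point of
the reflection, as the next lemma says for the other end. *)
Lemma cpos_end e : (0 < N)%N -> odd m != e -> (cpos 0 + cpos 0 = kap e %[mod N])%N.
Proof.
rewrite /cpos /kap /=; case: (odd m); case: e => //= N0 _.
  by rewrite !subn0 addn0 modnDr.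
by rewrite subnK // modnn mod0n.
Qed.

Lemma cpos_last q e : q.+1 = N -> odd q (+) odd m = e -> (cpos q + cpos q = kap e %[mod N])%N.
Proof.
move=> qN <-; have := uphalf_dbl q; rewrite /cpos /kap; move: (uphalf q) => u.
by case: (odd m); case: (odd q) => /= uE; congr (_ %% _)%N; lia.
Qed.

Lemma cpos_inj q q' : (q < N)%N -> (q' < N)%N -> cpos q = cpos q' %[mod N] -> q = q'.
Proof.
have M x : (x <= N)%N -> (0 < N)%N -> (x %% N = if x == N then 0 else x)%N.
  by case: eqP => [-> _|/eqP xN xle] N0; rewrite ?modnn // modn_small // ltn_neqAle xN.
move=> qN q'N; have := uphalf_dbl q; have := uphalf_dbl q'.
rewrite /cpos; move: (uphalf q) (uphalf q') => u u'.
case: (odd m); case: (odd q); case: (odd q') => /= E E'; rewrite !M; try lia;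
  by case: eqP => ?; case: eqP => ?; lia.
Qed.
End CyclePosition.

(** * The path of moved coordinates *)

Section Labels.
Variables (l l' m p : nat) (b : bool) (pos : 'I_l.+1 -> 'I_l.+1) (beta : nat -> rootA l).
Hypothesis pos_inj : injective pos.

(** The position, among all coordinates, of the q-th vertex of the path that
omits the positions m + 1, ..., m + p; [lab] below is its inverse. *)
Definition skip q := if (q <= m)%N then q else (q + p)%N.

Definition moved : {set 'I_l.+1} := [set x | (pos x <= m)%N || (m + p < pos x)%N].

Definition lab x := if (pos x <= m)%N then pos x : nat else (pos x - p)%N.

Lemma skip_lab x : x \in moved -> skip (lab x) = pos x.
Proof.
rewrite inE /skip /lab; case: (leqP (pos x) m) => [-> //|] /= _ lt.
by rewrite ifN ?subnK //; lia.
Qed.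

Lemma lab_inj : {in moved &, injective lab}.
Proof.
move=> x y xD yD E; apply: pos_inj; apply: val_inj => /=.
by rewrite -(skip_lab xD) -(skip_lab yD) E.
Qed.

Lemma skip_moved q x : pos x = skip q :> nat -> x \in moved /\ lab x = q.
Proof.
rewrite inE /lab /skip => ->; case: (leqP q m) => qm; first by rewrite qm.
by rewrite ifN ?ltn_add2r ?qm ?orbT ?addnK // -ltnNge ltn_addr.
Qed.

Hypotheses (lE : l = (l' + p)%N) (ml' : (m < l')%N).
Hypothesis betaE : forall q, (q < l')%N ->
  pos (src b (beta q)) = skip q :> nat /\ pos (dst b (beta q)) = skip q.+1 :> nat.

Lemma lab_lt x : (lab x < l'.+1)%N.
Proof. by rewrite /lab; have := ltn_ord (pos x); case: (leqP (pos x) m); lia. Qed.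

Lemma lab_src q : (q < l')%N -> src b (beta q) \in moved /\ lab (src b (beta q)) = q.
Proof. by case/betaE => H _; apply: skip_moved. Qed.

Lemma lab_dst q : (q < l')%N -> dst b (beta q) \in moved /\ lab (dst b (beta q)) = q.+1.
Proof. by case/betaE => _ H; apply: skip_moved. Qed.

Lemma meets_lab q x : (q < l')%N -> meets (beta q) x ->
  x \in moved /\ (lab x = q \/ lab x = q.+1).
Proof.
move=> ql; have [s1 s2] := lab_src ql; have [d1 d2] := lab_dst ql.
have -> : meets (beta q) x = (x == src b (beta q)) || (x == dst b (beta q)).
  by rewrite /meets /src /dst; case: (b); rewrite // orbC.
by case/orP => /eqP ->; split=> //; [left | right].
Qed.

Lemma beta_inj q q' : (q < l')%N -> (q' < l')%N -> beta q = beta q' -> q = q'.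
Proof. by move=> /lab_src[_ E] /lab_src[_ E'] eqb; rewrite -E -E' eqb. Qed.

Definition edges e := [seq beta q | q <- iota 0 l' & odd q (+) odd m == e].

Lemma mem_edges e a : reflect (exists2 q, (q < l')%N && (odd q (+) odd m == e) & a = beta q)
  (a \in edges e).
Proof.
by apply: (iffP mapP) => -[q]; rewrite ?mem_filter ?mem_iota => H ->; exists q;
  rewrite ?mem_filter ?mem_iota // andbC.
Qed.

Lemma edges_uniq e : uniq (edges e).
Proof.
rewrite map_inj_in_uniq ?filter_uniq ?iota_uniq // => q q'.
rewrite !mem_filter !mem_iota => /andP[_ ql] /andP[_ q'l]; exact: beta_inj.
Qed.

Lemma size_edges : (size (edges true) + size (edges false))%N = l'.
Proof.
rewrite !size_map !size_filter -[RHS](size_iota 0).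
rewrite -(count_predC (fun q => odd q (+) odd m == true)); congr (_ + _)%N.
by apply: eq_count => q /=; case: (_ (+) _).
Qed.

Section Matching.
Variables (e : bool) (gs : seq (rootA l)).
Hypotheses (gs_uniq : uniq gs) (gsE : gs =i edges e).

Lemma matching_disjoint : disjoint_roots gs.
Proof.
move=> a a'; rewrite !gsE => /mem_edges[q /andP[ql /eqP qe] ->].
move=> /mem_edges[q' /andP[ql' /eqP qe'] ->] x.
move=> /(meets_lab ql)[_ H] /(meets_lab ql')[_]; move: H => H H'; congr beta; move: H'.
have oq : odd q = odd q' by move: qe; rewrite -qe' => /addIb.
by case: H => ->; case=> qE; move: oq qE; clear; lia.
Qed.

Lemma matching_fix x : x \notin moved -> reflprod gs x = x.
Proof.
move=> xD; apply: reflprod_out => a; rewrite gsE => /mem_edges[q /andP[ql _] ->].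
by apply: contra xD => /(meets_lab ql)[].
Qed.

(** A vertex that an edge of the matching meets is moved to the other end of that
edge; only an end of the path can fail to be met. *)
Lemma matching_cpos x : x \in moved -> reflprod gs x \in moved /\
  (cpos m l'.+1 (lab (reflprod gs x)) + cpos m l'.+1 (lab x) =
     kap m l'.+1 e %[mod l'.+1])%N.
Proof.
move=> xD; have := lab_lt x; set q := lab x => ql.
have [/andP[q1 /eqP qe]|up] := boolP ((q < l')%N && (odd q (+) odd m == e)).
  have [sD sq] := lab_src q1; have [dD dq] := lab_dst q1.
  have xE : x = src b (beta q) by apply: lab_inj; rewrite ?sq.
  have bg : beta q \in gs by rewrite gsE; apply/mem_edges; exists q; rewrite ?q1 ?qe ?eqxx.
  have -> : reflprod gs x = dst b (beta q).
    rewrite (reflprod_in gs_uniq matching_disjoint bg) {1}xE ?refl_src //.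
    by case: (meets_ends b (beta q)).
  by rewrite dq addnC cpos_edge // qe.
have [/andP[q0 /eqP qe]|down] := boolP ((0 < q)%N && (odd q.-1 (+) odd m == e)).
  have q1 : (q.-1 < l')%N by lia.
  have [sD sq] := lab_src q1; have [dD dq] := lab_dst q1; rewrite prednK // in dq.
  have xE : x = dst b (beta q.-1) by apply: lab_inj; rewrite ?dq.
  have bg : beta q.-1 \in gs by rewrite gsE; apply/mem_edges; exists q.-1; rewrite ?q1 ?qe ?eqxx.
  have -> : reflprod gs x = src b (beta q.-1).
    rewrite (reflprod_in gs_uniq matching_disjoint bg) {1}xE ?refl_dst //.
    by case: (meets_ends b (beta q.-1)).
  by rewrite sq -[in X in (_ + X)%N](prednK q0) cpos_edge ?prednK // qe.
have -> : reflprod gs x = x.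
  apply: reflprod_out => a; rewrite gsE => /mem_edges[q' /andP[q'l qe'] ->].
  apply/negP => /(meets_lab q'l)[_ [H|H]]; rewrite -/q in H.
    by move: up; rewrite H q'l qe'.
  by move: down; rewrite H qe'.
split=> //; rewrite -/q.
have [q0|q0] := posnP q.
  rewrite q0; apply: cpos_end => //; move: up; rewrite q0 (leq_ltn_trans _ ml') //=.
have qe : odd q (+) odd m = e.
  move: down; rewrite q0 /= -{2}(prednK q0) /=.
  by case: (odd _); case: (odd m); case: (e).
by apply: cpos_last => //; move: up; rewrite qe eqxx andbT; lia.
Qed.
End Matching.
End Labels.

(** * Projection to a line in the Coxeter plane *)

Section CoxeterPlane.
Variables (R : realType) (m N : nat).

(** Angle, in eighths of a step of the N-gon, between the direction of projection
and the q-th vertex.  Without the perturbation the angles would be 4 q + 2, which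
hits the right angle 2 N for q = m + 1 when N = 2 m + 3; the correction of +1 or
-1 alternates with q, as vertices on both sides of the direction require. *)
Definition rank q := (4 * q + (if odd q (+) odd m then 3 else 1))%N.

Lemma rank_lt q q' : (q < q')%N -> (rank q < rank q')%N.
Proof. by rewrite /rank; case: ifP => _; case: ifP => _; lia. Qed.

Lemma rank_ltE q q' : (rank q < rank q')%N = (q < q')%N.
Proof.
case: (ltngtP q q') => [|/rank_lt/ltnW|->]; first exact: rank_lt.
  by rewrite leqNgt => /negPf.
by rewrite ltnn.
Qed.

Hypotheses (N_gt1 : (1 < N)%N) (mN : (m.*2.+2 <= N <= m.*2.+3)%N).

(** The projection of a point of the unit circle at an angle of t eighths of a
step; the range of angles is 0 <= t <= 4 N, half a turn. *)
Definition height (t : nat) : R := cos (omega R N * (t%:R / 8)).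

Lemma height_lt t t' : (t <= 4 * N)%N -> (t' <= 4 * N)%N ->
  (height t < height t') = (t' < t)%N.
Proof.
have w0 := omega_gt0 R N_gt1.
have B u : (u <= 4 * N)%N -> omega R N * (u%:R / 8) \in `[0, pi].
  move=> uN; rewrite in_itv /= mulr_ge0 ?(ltW w0) ?divr_ge0 //=.
  rewrite -(ler_pM2r (_ : 0 < 8 :> R)) //.
  rewrite (_ : omega R N * _ * 8 = omega R N * u%:R); last by field.
  rewrite (_ : pi * 8 = omega R N * (4 * N)%:R); last by rewrite natrM mulrCA omegaN //; ring.
  by rewrite ler_pM2l // ler_nat.
by move=> /B tB /B tB'; rewrite /height ltr_cos // ltr_pM2l // ltr_pM2r ?invr_gt0 // ltr_nat.
Qed.

Lemma height_quarter : height (2 * N) = 0.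
Proof.
rewrite /height natrM mulrA [_ * (2 * _)]mulrCA omegaN // -[RHS]cos_pihalf; congr cos.
by field.
Qed.

(** The direction of projection lies between the first two vertices, which are at
the places 0 and 1 for odd m, 0 and -1 for even m. *)
Definition phase : R := omega R N * ((if odd m then - 3 else 1) / 8).

Lemma cos_cpos q : (q < N)%N ->
  cos (1%:R * omega R N * (cpos m N q)%:R + phase) = height (rank q).
Proof.
move=> qN; have uE := uphalf_dbl q.
have uN : (uphalf q <= N)%N by lia.
have u2 : (uphalf q)%:R = (q%:R + (odd q)%:R) / 2 :> R.
  by rewrite -natrD -uE -muln2 natrM mulfK ?pnatr_eq0.
rewrite /cpos /height /rank /phase; case: ifP => qm.
  rewrite -[RHS]cosN -[RHS]cosD2pi -(omegaN R N_gt1); congr cos.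
  rewrite natrB // u2 natrD natrM; move: qm.
  by case: (odd q); case: (odd m) => //= _; field.
congr cos; rewrite u2 natrD natrM; move: qm.
by case: (odd q); case: (odd m) => //= _; field.
Qed.

Lemma rank_le q : (q < N)%N -> (rank q <= 4 * N)%N.
Proof. by rewrite /rank; case: ifP => _; lia. Qed.

(** At q = m the correction has the sign that keeps the angle below a right one;
in [rank_high], at q = m + 1, it has the sign that keeps it above. *)
Lemma rank_low q : (q <= m)%N -> (rank q < 2 * N)%N.
Proof.
rewrite leq_eqVlt => /orP[/eqP ->|]; rewrite /rank; first by rewrite addbb; lia.
by case: ifP => _; lia.
Qed.

Lemma rank_high q : (m < q)%N -> (2 * N < rank q)%N.
Proof.
rewrite leq_eqVlt => /orP[/eqP <-|]; rewrite /rank; first by rewrite /= addNb addbb /=; lia.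
by case: ifP => _; lia.
Qed.
End CoxeterPlane.

(** The two reflections compose to the rotation by one step, so the theory of
cycles applies to s.  The sign of b reverses both vectors when the numbering
runs from the lowest coordinate to the highest. *)
Lemma associated_labels (R : realType) (l l' m p : nat) (b : bool)
    (pos : 'I_l.+1 -> 'I_l.+1) (beta : nat -> rootA l)
    (gs1 gs2 : seq (rootA l)) (s : 'S_l.+1) :
  injective pos -> l = (l' + p)%N -> (m.*2 < l' <= m.*2.+2)%N ->
  (forall q, (q < l')%N ->
    pos (src b (beta q)) = skip m p q :> nat /\
    pos (dst b (beta q)) = skip m p q.+1 :> nat) ->
  uniq gs1 -> uniq gs2 ->
  gs1 =i edges l' m beta true -> gs2 =i edges l' m beta false ->
  (forall x, s x = reflprod gs1 (reflprod gs2 x)) ->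
  associated R s [set a | (pos (src b a) < pos (dst b a))%N].
Proof.
move=> pos_inj lE lm betaE u1 u2 e1 e2 sE.
have ml' : (m < l')%N by lia.
set D := moved m p pos; set N := l'.+1; pose lb := lab m p pos.
pose c x := cpos m N (lb x).
have N1 : (1 < N)%N by rewrite /N; lia.
have mN : (m.*2.+2 <= N <= m.*2.+3)%N by rewrite /N; lia.
have lbN x : (lb x < N)%N by apply: lab_lt.
have s1D := matching_cpos pos_inj lE ml' betaE u1 e1.
have s2D := matching_cpos pos_inj lE ml' betaE u2 e2.
have sC x : x \notin D -> s x = x.
  move=> xD; rewrite sE (matching_fix betaE e2 xD).
  exact: (matching_fix betaE e1 xD).
have sD x : x \in D -> s x \in D.
  by move=> xD; rewrite sE; case: (s1D _ (s2D _ xD).1).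
have sDE x : (s x \in D) = (x \in D).
  by have [/sD -> //|xD] := boolP (x \in D); rewrite sC ?(negPf xD).
have c_step x : x \in D -> c (s x) = (c x + 1)%N %[mod N].
  move=> xD; have [yD yE] := s2D x xD; have [_ zE] := s1D _ yD.
  rewrite -sE -/(c _) -/(c _) in zE; rewrite -/(c _) -/(c _) in yE.
  apply/eqP; rewrite -(eqn_modDr (c (reflprod gs2 x))) zE.
  by rewrite addnAC [(c x + _)%N]addnC -modnDml yE modnDml /kap addn0.
have c_inj : {in D &, forall x y, c x = c y %[mod N] -> x = y}.
  by move=> x y xD yD /cpos_inj E; apply: (lab_inj pos_inj xD yD); apply: E; apply: lbN.
have [x0 x0D] : exists x, x \in D.
  by exists (src b (beta 0)); case: (lab_src betaE (leq_ltn_trans (leq0n m) ml')).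
have D0 : D != set0 by apply/set0Pn; exists x0.
(* The coordinates outside D project to 0, like a point at a right angle. *)
pose T x := if x \in D then rank m (lb x) else (2 * N)%N.
have T_le x : (T x <= 4 * N)%N.
  by rewrite /T; case: ifP => _; [exact: rank_le | rewrite leq_mul2r orbT].
pose f : 'rV[R]_l.+1 := wave N D c 1 (phase R m N).
have fE x : f 0 x = height R N (T x).
  rewrite mxE /T; case: ifP => _; last by rewrite height_quarter.
  exact: cos_cpos.
have f_lt x y : (f 0 x < f 0 y) = (T y < T x)%N by rewrite !fE height_lt.
have DE z : (z \in D) = (pos z <= m)%N || (m + p < pos z)%N by rewrite inE.
have inD z : z \in D -> [/\ T z = rank m (lb z), (pos z <= m)%N,
      lb z = pos z & (T z < 2 * N)%N] \/
    [/\ T z = rank m (lb z), (m + p < pos z)%N, lb z = (pos z - p)%N & (2 * N < T z)%N].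
  move=> zD; rewrite /T zD; move: zD; rewrite DE /lb /lab.
  case: (leqP (pos z) m) => [zm _|mz /= zp]; [left | right]; split=> //.
    exact: rank_low.
  by apply: rank_high => //; lia.
have outD z : z \notin D -> [/\ T z = 2 * N, m < pos z & pos z <= m + p]%N.
  by move=> zD; rewrite /T (negPf zD); move: zD; rewrite DE negb_or -ltnNge -leqNgt => /andP[].
have T_pos x y : x \in D \/ y \in D -> (T x < T y)%N = (pos x < pos y)%N.
  have [xD|xD] := boolP (x \in D); have [yD|yD] := boolP (y \in D) => H.
  - case: (inD x xD) (inD y yD) => -[Tx xm lx xN] [] [Ty ym ly yN].
    + by rewrite Tx Ty rank_ltE lx ly.
    + by lia.
    + by lia.
    + by rewrite Tx Ty rank_ltE lx ly; lia.
  - by case: (inD x xD) (outD y yD) => -[_ ? _ ?] [-> ? ?]; lia.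
  - by case: (inD y yD) (outD x xD) => -[_ ? _ ?] [-> ? ?]; lia.
  - by case: H.
(* A fixed vector that decreases with the position outside D; its constant
   value on D makes the sum of its coordinates 0, and is never positive. *)
pose S := \sum_(x | x \notin D) (l.+1 - pos x)%:R : R.
pose g : 'rV[R]_l.+1 := \row_x if x \in D then - S / #|D|%:R else (l.+1 - pos x)%:R.
have g_neq x y : x != y -> x \notin D -> g 0 x != g 0 y.
  move=> xy xD; have S0 : - S / #|D|%:R <= 0.
    rewrite mulNr oppr_le0 divr_ge0 //; apply: sumr_ge0 => z _; exact: ler0n.
  have gx : 0 < (l.+1 - pos x)%:R :> R by rewrite ltr0n subn_gt0 ltn_ord.
  rewrite !mxE (negPf xD); case: ifP => _; first by rewrite gt_eqF // (le_lt_trans S0).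
  rewrite eqr_nat; apply: contra xy => /eqP E; apply/eqP/pos_inj/val_inj => /=.
  by have := ltn_ord (pos x); have := ltn_ord (pos y); lia.
have gF : g \in fixsp R s.
  rewrite mem_fixsp mem_hR (bigID (mem D)) /=; apply/andP; split.
    under eq_bigr => x xD do rewrite mxE xD.
    under [X in _ + X]eq_bigr => x xD do rewrite mxE (negPf xD).
    rewrite sumr_const -/S -[_ *+ #|_|]mulr_natr mulfVK ?addNr //.
    by rewrite pnatr_eq0 cards_eq0.
  apply/eqP/act_inj_rowP => x; rewrite !mxE sDE.
  by case: ifPn => // /sC ->.
have pairE (h : 'rV[R]_l.+1) a : pairing (sg R b *: h) a = h 0 (src b a) - h 0 (dst b a).
  by rewrite pairingE !mxE /sg /src /dst; case: (b); rewrite ?mul1r // !mulN1r opprK addrC.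
have sgE (h : 'rV[R]_l.+1) x : (sg R b *: h) 0 x = sg R b * h 0 x by rewrite mxE.
have f_pos x y : x \in D \/ y \in D -> (f 0 y < f 0 x) = (pos x < pos y)%N.
  by move=> xy; rewrite f_lt T_pos.
(* The projection separates src and dst unless both are outside D, where the
   fixed vector takes over. *)
rewrite (_ : [set a | _] = [set a | if pairing (sg R b *: f) a == 0
  then 0 < pairing (sg R b *: g) a else 0 < pairing (sg R b *: f) a]).
  apply: (associated_waves (D := D) (N := N) (c := c)) => //.
  - by rewrite rpredZ // wave_sp.
  - by rewrite rpredZ.
  - move=> x y xD yD; rewrite !sgE => /(mulfI (sg_neq0 R b)) fxy; apply/pos_inj/val_inj => /=.
    have := f_pos x y (or_introl xD); have := f_pos y x (or_introl yD).
    by rewrite fxy ltxx; case: ltngtP.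
  - move=> x xD; rewrite sgE mulf_neq0 ?sg_neq0 //; apply/eqP => fx0.
    have := height_lt R N1 (T_le x) (leq_mul (isT : 2 <= 4)%N (leqnn N)).
    have := height_lt R N1 (leq_mul (isT : 2 <= 4)%N (leqnn N)) (T_le x).
    rewrite -fE fx0 height_quarter // ltxx.
    by case: (inD x xD) => -[_ _ _ TN]; rewrite TN.
  - by move=> x y xy xD; rewrite !sgE (inj_eq (mulfI (sg_neq0 R b))); apply: g_neq.
apply/setP => a; rewrite !inE !pairE; set x := src b a; set y := dst b a.
have xy : x != y := src_neq_dst b a.
rewrite subr_eq0 !subr_gt0; have [fxy|fxy] := eqVneq (f 0 x) (f 0 y).
  have off z w : f 0 z = f 0 w -> z != w -> z \notin D.
    move=> fzw zw; apply/negP => zD; move/eqP: zw; apply; apply/pos_inj/val_inj => /=.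
    have := f_pos z w (or_introl zD); have := f_pos w z (or_intror zD).
    by rewrite fzw ltxx; case: ltngtP.
  have xD := off x y fxy xy; have yD : y \notin D by apply: (off y x); rewrite 1?eq_sym.
  rewrite !mxE (negPf xD) (negPf yD) ltr_nat.
  by have := ltn_ord (pos x); have := ltn_ord (pos y); lia.
rewrite f_pos //; have [|xD] := boolP (x \in D); first by left.
right; apply: contraNT fxy => yD; apply/eqP; rewrite !fE /T.
by rewrite (negPf xD) (negPf yD).
Qed.

(** * The four forms *)

Section Forms.
Variables (l l' m p : nat) (alpha : nat -> rootA l) (gamma : rootA l).

Definition path_edge q :=
  if (q < m)%N then alpha q.+1 else if q == m then gamma else alpha (q + p).+1.

Lemma mem_steps2 a b i : (i \in steps2 a b) = (a <= i <= b)%N && (odd i == odd a).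
Proof.
rewrite mem_filter mem_iota andbC (_ : (i < a + (b.+1 - a))%N = (a <= i <= b)%N || (i < a)%N); last by lia.
case: (leqP a i) => //= ai; rewrite orbF oddB //.
by case: (odd i); case: (odd a).
Qed.

(** The indices of the simple roots that are edges of the path and belong to s_1
(e = true) or s_2 (e = false).  The edge gamma, which belongs to s_2, is the only
one that need not be simple. *)
Definition simple_index e i :=
  ((0 < i <= m)%N && (odd i (+) odd m != e)) ||
  ((m + p + 2 <= i <= l' + p)%N && (odd i (+) odd p (+) odd m != e)).

Lemma mem_simple_index e L a : (m < l')%N -> (forall i, (i \in L) = simple_index e i) ->
  (a \in [seq alpha i | i <- L]) <->
  exists2 q, [&& (q < l')%N, q != m & odd q (+) odd m == e] & a = path_edge q.
Proof.
move=> ml' LE; split=> [/mapP[i] | [q /and3P[ql qm qe] ->]].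
  rewrite LE => /orP[] /andP[/andP[i1 i2] ie] ->.
    exists i.-1; last by rewrite /path_edge prednK // i2.
    apply/and3P; split; [lia | lia |].
    by move: ie; rewrite -{1}(prednK i1) /=; case: (odd _); case: (odd m); case: (e).
  have i0 : (0 < i)%N by lia.
  exists (i.-1 - p)%N.
    apply/and3P; split; [lia | lia | rewrite oddB; last by lia].
    by move: ie; rewrite -{1}(prednK i0) /=; case: (odd _); case: (odd p); case: (odd m); case: (e).
  rewrite /path_edge ifN ?ifN ?subnK ?prednK //; lia.
rewrite /path_edge (negPf qm); case: ifP => qm'.
  apply: map_f; rewrite LE /simple_index /= qm' -(eqP qe).
  by case: (odd q); case: (odd m).
apply: map_f; rewrite LE /simple_index /= -(eqP qe) oddD; apply/orP; right.
by apply/andP; split; [lia | case: (odd q); case: (odd p); case: (odd m)].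
Qed.

Lemma mem_edges_true L (gs : seq (rootA l)) : (m < l')%N -> (forall i, (i \in L) = simple_index true i) ->
  gs =i [seq alpha i | i <- L] -> gs =i edges l' m path_edge true.
Proof.
move=> ml' LE gsE a; rewrite gsE; apply/idP/mem_edges.
  case/(mem_simple_index a ml' LE) => q /and3P[ql _ qe] ->.
  by exists q; rewrite ?ql.
move=> [q /andP[ql qe] ->]; apply/(mem_simple_index _ ml' LE); exists q => //.
by rewrite ql qe andbT; apply: contraTneq qe => ->; rewrite addbb.
Qed.

Lemma mem_edges_false L1 L2 (gs : seq (rootA l)) : (m < l')%N ->
  (forall i, (i \in L1 ++ L2) = simple_index false i) ->
  gs =i [seq alpha i | i <- L1] ++ gamma :: [seq alpha i | i <- L2] ->
  gs =i edges l' m path_edge false.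
Proof.
move=> ml' LE gsE a.
have -> : (a \in gs) = (a == gamma) || (a \in [seq alpha i | i <- L1 ++ L2]).
  by rewrite gsE map_cat !mem_cat inE orbCA.
apply/idP/mem_edges.
  case/orP => [/eqP ->|].
    by exists m; rewrite ?ml' ?addbb // /path_edge ltnn eqxx.
  case/(mem_simple_index a ml' LE) => q /and3P[ql _ qe] ->.
  by exists q; rewrite ?ql.
move=> [q /andP[ql qe] ->]; have [->|qm] := eqVneq q m.
  by rewrite /path_edge ltnn !eqxx.
by apply/orP; right; apply/(mem_simple_index _ ml' LE); exists q; rewrite ?ql ?qm.
Qed.
End Forms.

Unset Implicit Arguments.

Theorem proposition4p3p2 (R : realType) (l l' m p : nat)
  (s s1 s2 : 'S_l.+1) (gs1 gs2 : seq (rootA l))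
  (P : {set rootA l}) (alpha : nat -> rootA l) (gamma : rootA l)
  (cycle_s : single_cycle s)
  (def_s : forall i, s i = s1 (s2 i))
  (def_s1 : s1 = reflprod gs1) (def_s2 : s2 = reflprod gs2)
  (invol_s1 : (s1 * s1)%g = 1%g) (invol_s2 : (s2 * s2)%g = 1%g)
  (def_l' : (size gs1 + size gs2)%N = l')
  (pos_P : positive_system R P)
  (simple_alpha : simple_numbering R P alpha)
  (def_m : m = ((l' - 1)./2)%N)
  (def_p : l = (l' + p)%N)
  (def_gamma :
     rootv R gamma = \sum_(m + 1 <= i < (m + p + 1).+1) rootv R (alpha i))
  (forms :
     [\/ [/\ ~~ odd m, odd l',
             gs1 =i [seq alpha i | i <- steps2 2 m ++
                                        steps2 (m + p + 2) (m + p + m)] &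
             gs2 =i [seq alpha i | i <- steps2 1 (m - 1)] ++ gamma ::
                    [seq alpha i | i <- steps2 (m + p + 3) (m + p + m + 1)]],
         [/\ ~~ odd m, ~~ odd l',
             gs1 =i [seq alpha i | i <- steps2 2 m ++
                                        steps2 (m + p + 2) (m + p + m + 2)] &
             gs2 =i [seq alpha i | i <- steps2 1 (m - 1)] ++ gamma ::
                    [seq alpha i | i <- steps2 (m + p + 3) (m + p + m + 1)]],
         [/\ odd m, odd l',
             gs1 =i [seq alpha i | i <- steps2 1 m ++
                                        steps2 (m + p + 2) (m + p + m + 1)] &
             gs2 =i [seq alpha i | i <- steps2 2 (m - 1)] ++ gamma ::
                    [seq alpha i | i <- steps2 (m + p + 3) (m + p + m)]] |
         [/\ odd m, ~~ odd l',
             gs1 =i [seq alpha i | i <- steps2 1 m ++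
                                        steps2 (m + p + 2) (m + p + m + 1)] &
             gs2 =i [seq alpha i | i <- steps2 2 (m - 1)] ++ gamma ::
                    [seq alpha i | i <- steps2 (m + p + 3) (m + p + m + 2)]]]) :
  associated R s P.
Proof.
have l'0 : (0 < l')%N.
  have : gamma \in gs2 by case: forms => -[_ _ _ ->]; rewrite mem_cat mem_head orbT.
  by rewrite -def_l'; case: (gs2) => //= *; rewrite addnS.
have lm : (m.*2 < l' <= m.*2.+2)%N by rewrite def_m; lia.
have ml' : (m < l')%N by lia.
have {forms} [e1 e2] : gs1 =i edges l' m (path_edge m p alpha gamma) true /\
    gs2 =i edges l' m (path_edge m p alpha gamma) false.
  have lE : l' = (m.*2 + 2 - odd l')%N by lia.
  case: forms => -[om ol g1 g2]; rewrite ?om ?ol ?(negPf ol) in lE; clear def_m;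
    (split; [apply: mem_edges_true g1 | apply: mem_edges_false g2] => // i;
     rewrite mem_cat !mem_steps2 /simple_index lE !oddD ?oddS /=;
     move: om; case: (boolP (odd m)) => Om //= _;
     (case: (boolP (odd p)) => Op); (case: (boolP (odd i)) => Oi);
     rewrite ?(negPf Om) ?Om /= ?andbF ?andbT ?orbF; clear -Om Oi Op; lia).
have [b [pos [pos_inj posE PE]]] := positions simple_alpha ltac:(lia).
have betaE q : (q < l')%N ->
    pos (src b (path_edge m p alpha gamma q)) = skip m p q :> nat /\
    pos (dst b (path_edge m p alpha gamma q)) = skip m p q.+1 :> nat.
  have one i : rootv R (alpha i.+1) = \sum_(i.+1 <= k < i.+2) rootv R (alpha k).
    by rewrite big_nat1.
  move=> ql; rewrite /path_edge /skip; case: (ltngtP q m) => qm.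
  - by apply: posE; rewrite ?one //; lia.
  - by rewrite -addSn; apply: posE; rewrite ?one //; lia.
  - by rewrite qm addSn; apply: posE; rewrite ?def_gamma ?addn1 //; lia.
rewrite PE.
have [z1 z2] : (size (edges l' m (path_edge m p alpha gamma) true) <= size gs1)%N /\
    (size (edges l' m (path_edge m p alpha gamma) false) <= size gs2)%N.
  by split; apply: uniq_leq_size (edges_uniq betaE _) _ => a; rewrite ?e1 ?e2.
have zz := size_edges l' m (path_edge m p alpha gamma).
apply: (associated_labels R pos_inj def_p lm betaE _ _ e1 e2).
(* The path has l' edges, as many as the two lists have entries, so neither
   list repeats a root. *)
- apply: leq_size_uniq (edges_uniq betaE true) _ _ => [a|]; rewrite ?e1 //.
  by rewrite -(leq_add2r (size gs2)) def_l' -[leqLHS]zz leq_add2l.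
- apply: leq_size_uniq (edges_uniq betaE false) _ _ => [a|]; rewrite ?e2 //.
  by rewrite -(leq_add2l (size gs1)) def_l' -[leqLHS]zz leq_add2r.
- by move=> x; rewrite def_s def_s1 def_s2.
Qed.
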